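(* Let $l_1>l_2>\cdots>l_J$ be the free-flow travel times, and let the commuting disutility be $$c_{j,k}(s)=\alpha_kl_j+\beta_kf(s)+\gamma_kg(s-l_j)\quad(s\le0),\qquad c_{j,k}(s)=+\infty\quad(s>0),$$ for $j\in\mathcal J=\{1,\dots,J\}$, $k\in\mathcal K=\{1,\dots,K\}$, where $0<\alpha_1<\cdots<\alpha_K$, $0<\beta_1<\cdots<\beta_K$, $0<\gamma_1<\cdots<\gamma_K$; $f$ is continuous on $(-\infty,0]$ with $f\ge0$ and $f'(s)<0$ for all $s\le0$; and $g$ is continuous with $g(t)>0$, $g'(t)<0$, $g''(t)<0$ for all $t\le-l_J$. Let $\mu>0$, $R_j>0$, $Q_k>0$ with $\sum_jR_j=\sum_kQ_k=Q$, $T=Q/\mu$, and consider $$\text{[3D-LP]}\quad\min_{\mathbf{x}\ge0}\ \sum_{j}\sum_{k}\int_{\mathcal S}c_{j,k}(s)x_{j,k}(s)\,\mathrm{d}s$$ subject to $\sum_j\sum_kx_{j,k}(s)\le\mu$ for all $s\in\mathcal S$, $\ \sum_k\int_{\mathcal S}x_{j,k}(s)\,\mathrm{d}s\le R_j$ for all $j\in\mathcal J$, $\ \sum_j\int_{\mathcal S}x_{j,k}(s)\,\mathrm{d}s\ge Q_k$ for all $k\in\mathcal K$. Then the solution $\mathbf{x}^*$ of [3D-LP] is unique, and its cumulative form $F^*(\zeta,\kappa,s)=\sum_{j'\le\zeta}\sum_{k'\le\kappa}\int_{-T}^sx^*_{j',k'}(s')\,\mathrm{d}s'$ is given, for all $\zeta\in[1,J]$,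 $\kappa\in[1,K]$, $s\in[-T,0]$, by $$F^*(\zeta,\kappa,s)=\min\Big\{\sum_{j'\le\zeta}R_{j'},\ \sum_{k'\le\kappa}Q_{k'},\ \mu\,(T+s)\Big\}.$$
   Context: $\mathcal S\subset\mathbb R$ is a given, sufficiently long time interval (containing $[-T,0]$). The unknowns $x_{j,k}$ are nonnegative measurable functions on $\mathcal S$: $x_{j,k}(s)$ is the flow rate of users living at location $j$ with job $k$ departing at time $s$ from a single bottleneck of capacity $\mu$. Constraints on $s$ hold for almost every $s$, and flows equal almost everywhere are identified. Cost $+\infty$ for $s>0$ means $x_{j,k}(s)=0$ for almost every $s>0$ (late arrival prohibited). The indices $j',k'$ in the sums range over integers, while $\zeta,\kappa$ are real. *)

(* Defs.v *)
From HB Require Import structures.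
From mathcomp Require Import all_boot all_order all_algebra.
From mathcomp Require Import all_classical all_reals all_analysis.
Import Order.TTheory GRing.Theory Num.Theory.
Import numFieldNormedType.Exports.

Set Implicit Arguments.
Unset Strict Implicit.
Unset Printing Implicit Defensive.

Local Open Scope classical_set_scope.
Local Open Scope ring_scope.

(* Locations and jobs are numbered from 0: [j : 'I_J.+1] is location [j.+1]
   among [J.+1] locations, and [k : 'I_K.+1] is job [k.+1] among [K.+1] jobs.
   In particular the location with the smallest travel time is [ord_max]. *)

(* [d] is the derivative at [x] of [h] as a function on [A]: the values of [h]
   outside [A] are irrelevant, and at an end point of an interval [A] this is
   the one-sided derivative. *)
Definition is_derive_within (R : realType) (A : set R) (h : R -> R)
    (x d : R) : Prop :=
  (h y - h x) / (y - x) @[y --> within A x^'] --> d.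

Section bottleneck.
Context {R : realType} {J K : nat}.

Definition flow : Type := 'I_J.+1 -> 'I_K.+1 -> R -> R.

Definition cost (l : 'I_J.+1 -> R) (alpha beta gamma : 'I_K.+1 -> R)
    (f g : R -> R) (j : 'I_J.+1) (k : 'I_K.+1) (s : R) : \bar R :=
  if s <= 0 then (alpha k * l j + beta k * f s + gamma k * g (s - l j))%:E
  else +oo%E.

(* Since [+oo * 0 = 0] in [\bar R], a flow departing after time 0 on a set of
   positive measure costs [+oo], and a flow vanishing there costs nothing. *)
Definition objective (S : set R) (c : 'I_J.+1 -> 'I_K.+1 -> R -> \bar R)
    (x : flow) : \bar R :=
  (\sum_(j < J.+1) \sum_(k < K.+1)
    \int[lebesgue_measure]_(s in S) (c j k s * (x j k s)%:E))%E.

Definition ae_on (S : set R) (P : R -> Prop) : Prop :=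
  {ae lebesgue_measure, forall s : R, S s -> P s}.

Record feasible (S : set R) (mu : R) (Rj : 'I_J.+1 -> R) (Qk : 'I_K.+1 -> R)
    (x : flow) : Prop := Feasible {
  flow_measurable : forall j k, measurable_fun S (x j k);
  flow_ge0 : forall j k, ae_on S (fun s => 0 <= x j k s);
  flow_capacity :
    ae_on S (fun s => \sum_(j < J.+1) \sum_(k < K.+1) x j k s <= mu);
  flow_location : forall j,
    (\sum_(k < K.+1) \int[lebesgue_measure]_(s in S) (x j k s)%:E
       <= (Rj j)%:E)%E;
  flow_job : forall k,
    ((Qk k)%:E
       <= \sum_(j < J.+1) \int[lebesgue_measure]_(s in S) (x j k s)%:E)%E }.

Definition is_solution (S : set R) (mu : R) (Rj : 'I_J.+1 -> R)
    (Qk : 'I_K.+1 -> R) (c : 'I_J.+1 -> 'I_K.+1 -> R -> \bar R)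
    (x : flow) : Prop :=
  feasible S mu Rj Qk x /\
  forall y, feasible S mu Rj Qk y -> (objective S c x <= objective S c y)%E.

Definition cumulative_flow (T : R) (x : flow) (zeta kappa s : R) : \bar R :=
  (\sum_(j < J.+1 | (j.+1%:R <= zeta)%R)
    \sum_(k < K.+1 | (k.+1%:R <= kappa)%R)
      \int[lebesgue_measure]_(s' in `[(- T)%R, s]) (x j k s')%:E)%E.

End bottleneck.

Arguments flow : clear implicits.

(* Main.v *)
Require Import Defs.
From HB Require Import structures.
From mathcomp Require Import all_boot all_order all_algebra.
From mathcomp Require Import ring lra.
From mathcomp Require Import all_classical all_reals all_analysis.
From mathcomp Require Import measurable_realfun.
Import Order.TTheory GRing.Theory Num.Theory.
Import numFieldNormedType.Exports.

Set Implicit Arguments.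
Unset Strict Implicit.
Unset Printing Implicit Defensive.

Local Open Scope classical_set_scope.
Local Open Scope ring_scope.
(* Linear programming duality. The cost c(j,k,s) has strictly decreasing
   increments jointly in every pair of its arguments. Let phi and psi sum the
   increments of c in j and in k at the times where the sorted flow switches
   location or job, each increment being taken at the job or location active at
   that time. Then c(j,k,s) - phi(j) - psi(k) has a unique minimum over (j,k),
   attained at the pair which the sorted flow serves at time s; this minimum lies
   below C = c(0,0,-T) for -T < s < 0 and above C for s < -T. All supply and
   demand constraints are tight because both totals equal Q, so the difference
   of the costs of a feasible flow y and the sorted flow x is the integral of
   sum_(j,k) (c - phi - psi - C)(y - x), which is nonnegative and vanishes only
   where y = x. *)

(** The multipliers must be separable in [j] and [k], whereas an increment of [c] in [j] depends on
    [k] and conversely. The lattice path followed by the sorted flow resolves this. Kept inside the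
    rectangle with corner [(j,k)], it writes [c j k s] as a sum of increments in which the other
    index is merely capped. Capping lowers that index and so, by submodularity in [(j,k)], can only
    raise the increment; at the served pair no cap is effective. Without the caps the expression
    splits into a sum over [j] and a sum over [k], whose terms are negative for past switches and
    positive for future ones, because increments decrease in time. The constant [C] comes from the
    pair [(0,0)]: its potentials vanish and it is served first, so comparison with this single pair
    places the minimum relative to [C] at all times. During the rush, [C] minus the minimum is the
    price of capacity. The analytic obstacle is that costs may be [+oo] and need not be bounded on
    [S]. Finiteness of the total cost must first yield the absence of late flow and the
    integrability of each term; a lower bound on [c] uniform in time makes this possible. *)

(** * Monotonicity from one-sided derivatives *)

Lemma is_derive_of_within (R : realType) (h : R -> R) (b x d : R) :
  x < b -> is_derive_within `]-oo, b] h x d -> is_derive x 1 h d.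
Proof.
move=> xb hd.
have hd' : (h y - h x) / (y - x) @[y --> x^'] --> d.
  move: hd; rewrite /is_derive_within => hd A /hd.
  (* Strictly left of [b] a whole neighbourhood lies in the half-line, so the restriction is
     void. *)
  have yb : \forall y \near x, y < b by exact: lt_nbhsl.
  rewrite /nbhs /= /within /= => hA; apply: filterS2 yb hA => y yb hA yx.
  by apply: hA => //=; rewrite in_itv/= ltW.
have {}hd' : t^-1 *: (h (t *: 1 + x) - h x) @[t --> 0^'] --> d.
  apply/cvgrPdist_lt => e e0; move/cvgrPdist_lt : hd' => /(_ _ e0).
  rewrite /dnbhs /= !near_withinE => H.
  have tx : (fun t : R => t + x) @ nbhs (0 : R) --> x.
    by rewrite -[X in _ --> X]add0r; apply: cvgD; [exact: cvg_id|exact: cvg_cst].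
  have := tx _ H; rewrite /= => Ht.
  have {}Ht : \forall t \near (0 : R), t + x != x ->
    `|d - (h (t + x) - h x) / (t + x - x)| < e := Ht.
  apply: filterS Ht => t; rewrite addrK => H' t0.
  rewrite /GRing.scale/= mulr1 mulrC; apply: H'.
  by rewrite -subr_eq0 addrK.
split; last by apply/cvg_lim.
by apply/cvg_ex; exists d.
Qed.

Lemma decreasing_of_derive_lt0 (R : realType) (h h' : R -> R) (b : R) :
  {within `]-oo, b], continuous h} ->
  (forall x, x < b -> is_derive x 1 h (h' x)) -> (forall x, x < b -> h' x < 0) ->
  forall x y, x < y -> y <= b -> h y < h x.
Proof.
move=> hc hd h0 x y xy yb.
have [c|c|c] := @MVT R h h' x y xy.
- by rewrite in_itv/= => /andP[_ cy]; apply: hd; exact: lt_le_trans yb.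
- apply: (continuous_subspaceW _ hc) => z /=; rewrite !in_itv/= => /andP[_ zy].
  exact: le_trans yb.
- rewrite in_itv/= => /andP[_ cy] hxy.
  rewrite -subr_lt0 hxy pmulr_llt0 ?subr_gt0//.
  by apply: h0; exact: lt_le_trans yb.
Qed.

Lemma decreasing_of_derive_within (R : realType) (h h' : R -> R) (b : R) :
  {within `]-oo, b], continuous h} ->
  (forall x, x <= b -> is_derive_within `]-oo, b] h x (h' x)) ->
  (forall x, x <= b -> h' x < 0) ->
  forall x y, x < y -> y <= b -> h y < h x.
Proof.
move=> hc hd h0; apply: (@decreasing_of_derive_lt0 R h h') => // x xb.
  by apply: (is_derive_of_within xb); apply: hd; exact: ltW.
by apply: h0; exact: ltW.
Qed.

Lemma continuous_within_shift (R : realType) (h : R -> R) (b c d : R) :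
  {within `]-oo, b], continuous h} -> d - c <= b ->
  {within `]-oo, d], continuous (fun s => h (s - c))}.
Proof.
move=> /subspace_continuousP hc dcb; apply/subspace_continuousP => x.
rewrite /= in_itv/= => xd.
have /cvgrPdist_lt hx : h y @[y --> within `]-oo, b] (nbhs (x - c))] --> h (x - c).
  by apply: hc; rewrite /= in_itv/=; apply: le_trans dcb; rewrite lerB.
apply/cvgrPdist_lt => e e0; have := hx _ e0; rewrite !near_withinE => H.
have yc : (fun y : R => y - c) @ nbhs x --> x - c.
  by apply: cvgB; [exact: cvg_id|exact: cvg_cst].
have {}H : \forall y \near x, y - c \in `]-oo, b] -> `|h (x - c) - h (y - c)| < e := yc _ H.
apply: filterS H => y Hy; rewrite /= in_itv/= => yd; apply: Hy.
by rewrite in_itv/=; apply: le_trans dcb; rewrite lerB.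
Qed.

(** By strict concavity [g'] is strictly decreasing, and [x - d < x - c]; hence the derivative
    [g' (x - c) - g' (x - d)] of the increment is negative. *)
Lemma decreasing_increment (R : realType) (g g' g'' : R -> R) (b c d : R) :
  {within `]-oo, b], continuous g} ->
  (forall t, t <= b -> is_derive_within `]-oo, b] g t (g' t)) ->
  (forall t, t <= b -> is_derive_within `]-oo, b] g' t (g'' t)) ->
  (forall t, t <= b -> g'' t < 0) ->
  c < d -> - c <= b ->
  forall x y, x < y -> y <= 0 -> g (y - c) - g (y - d) < g (x - c) - g (x - d).
Proof.
move=> gc gd g'd g''0 cd cb.
have ltb (e x : R) : - e <= b -> x < 0 -> x - e < b.
  by move=> eb x0; apply: lt_le_trans eb; rewrite gtrDr.
have db : - d <= b by apply: le_trans cb; rewrite lerN2 ltW.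
have dg (e x : R) : - e <= b -> x < 0 -> is_derive x 1 (fun s => g (s - e)) (g' (x - e)).
  move=> eb x0; have gx := is_derive_of_within (ltb _ _ eb x0) (gd _ (ltW (ltb _ _ eb x0))).
  have sx := @is_derive_shift R x 1 (- e).
  by have := @is_derive1_comp _ g (shift (- e)) x _ _ gx sx; rewrite mulr1.
have g'lt (x y : R) : x < y -> y < b -> g' y < g' x.
  move=> xy yb; have [z||z] := @MVT R g' g'' x y xy.
  - rewrite in_itv/= => /andP[_ zy]; have zb := lt_trans zy yb.
    by apply: (is_derive_of_within zb); apply: g'd; exact: ltW.
  - apply: derivable_within_continuous => z; rewrite in_itv/= => /andP[_ zy].
    have zb := le_lt_trans zy yb.
    by have [] := is_derive_of_within zb (g'd _ (ltW zb)).
  - rewrite in_itv/= => /andP[_ zy] E.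
    rewrite -subr_lt0 E pmulr_llt0 ?subr_gt0//.
    by apply: g''0; exact: ltW (lt_trans zy yb).
apply: (@decreasing_of_derive_lt0 R (fun s => g (s - c) - g (s - d))
  (fun s => g' (s - c) - g' (s - d))).
- have cc : {within `]-oo, 0], continuous (fun s => g (s - c))}.
    by apply: continuous_within_shift gc _; rewrite sub0r.
  have dc : {within `]-oo, 0], continuous (fun s => g (s - d))}.
    by apply: continuous_within_shift gc _; rewrite sub0r.
  by move=> x; apply: cvgB; [exact: cc|exact: dc].
- by move=> x x0; apply: is_deriveB; apply: dg.
- by move=> x x0; rewrite subr_lt0; apply: g'lt; [rewrite ltrD2l ltrN2|exact: ltb].
Qed.

(** * Lattice paths of increments and separable potentials *)

Definition diff1 (R : zmodType) (c : nat -> nat -> R -> R) (i k : nat) (s : R) : R :=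
  c i.+1 k s - c i k s.
Definition diff2 (R : zmodType) (c : nat -> nat -> R -> R) (j m : nat) (s : R) : R :=
  c j m.+1 s - c j m s.

Lemma initial_segment_bound (p : nat -> bool) (n : nat) :
  (forall i i', (i <= i' < n)%N -> p i' -> p i) ->
  exists2 m, (m <= n)%N & forall i, (i < n)%N -> (i < m)%N = p i.
Proof.
elim: n => [|n IH] pd; first by exists 0%N.
have [|m mn mP] := IH.
  by move=> i i' /andP[ii' i'n]; apply: pd; rewrite ii' ltnW.
have [pn|pn] := boolP (p n).
  exists n.+1 => // i; rewrite ltnS => i_n; apply/esym.
  by rewrite i_n; apply: (pd i n) => //; rewrite i_n ltnSn.
exists m; first exact: leqW.
move=> i; rewrite ltnS leq_eqVlt => /orP[/eqP->|]; last exact: mP.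
by rewrite (negbTE pn); apply/negbTE; rewrite -leqNgt.
Qed.

(* The increments of c along a monotone lattice path from (0,0) to (j,k): the
   thresholds kk and jj describe one staircase, which is followed until it
   leaves the rectangle. *)
Lemma staircase_telescope (R : zmodType) (c : nat -> nat -> R -> R) (s : R)
    (J K : nat) (kk jj : nat -> nat) :
  (forall i m, (i < J)%N -> (m < K)%N -> (m < kk i)%N = ~~ (i < jj m)%N) ->
  forall j k, (j <= J)%N -> (k <= K)%N ->
  c j k s - c 0%N 0%N s = \sum_(i < j) diff1 c i (minn k (kk i)) s
                        + \sum_(m < k) diff2 c (minn j (jj m)) m s.
Proof.
move=> kj j k; move: {2}(j + k)%N (leqnn (j + k)) => n.
elim: n j k => [|n IH] j k.
  by rewrite leqn0 addn_eq0 => /andP[/eqP-> /eqP->] _ _; rewrite !big_ord0 subrr addr0.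
move=> jkn jJ kK.
(* The corner decides the last step of the path: in [j] if [k] is zero or the threshold of the
   previous location reaches [k], in [k] otherwise. Every term of the other sum has already met its
   threshold, so shortening the rectangle does not change it. *)
have [/andP[j0 b]|] := boolP ((0 < j) && ((k == 0) || (k.-1 < kk j.-1)))%N.
  case: j j0 jkn jJ b => // j _ jkn jJ b.
  have kle : (k <= kk j)%N.
    by case: k b {jkn kK} => // k /=.
  rewrite big_ord_recr/= (minn_idPl kle) /diff1 addrAC.
  have -> : \sum_(m < k) diff2 c (minn j.+1 (jj m)) m s =
            \sum_(m < k) diff2 c (minn j (jj m)) m s.
    apply: eq_bigr => m _.
    have : ~~ (j < jj m)%N.
      by rewrite -kj ?(leq_trans (ltn_ord m))//; exact: leq_trans kK.
    by rewrite -leqNgt => jm; rewrite (minn_idPr jm) (minn_idPr (leqW jm)).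
  by rewrite -IH// ?(ltnW jJ)// addrC addrA subrK.
move=> b.
case: k jkn kK b => [|k] jkn kK b.
  case: j jkn jJ b => //= _ _ _; by rewrite !big_ord0 subrr addr0.
have kle : (j <= jj k)%N.
  case: j jkn jJ b => //= j jkn jJ b.
  by move: b; rewrite kj// negbK.
rewrite (big_ord_recr k)/= (minn_idPl kle) /diff2 addrA.
have -> : \sum_(i < j) diff1 c i (minn k.+1 (kk i)) s =
          \sum_(i < j) diff1 c i (minn k (kk i)) s.
  apply: eq_bigr => i _.
  have : ~~ (k < kk i)%N.
    rewrite kj// ?(leq_trans (ltn_ord i))// negbK; exact: leq_trans kle.
  by rewrite -leqNgt => km; rewrite (minn_idPr km) (minn_idPr (leqW km)).
have -> : forall a b d : R, a + b + d = d + (a + b) by move=> a' b' d; rewrite addrC.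
have jkn' : (j + k <= n)%N by rewrite -ltnS -addnS.
by rewrite -(IH j k)// ?(ltnW kK)// addrA subrK.
Qed.

(** The partial sums fall as long as the terms are negative and rise afterwards, so [j'] is their
    only minimiser. Uniqueness of the served location and job rests on this. *)
Lemma sum_initial_le (R : realDomainType) (d : nat -> R) (n j j' : nat) :
  (j <= n)%N -> (j' <= n)%N ->
  (forall i, (i < n)%N -> (i < j')%N -> d i < 0) ->
  (forall i, (i < n)%N -> (j' <= i)%N -> 0 < d i) ->
  (\sum_(i < j') d i <= \sum_(i < j) d i) /\
  (j != j' -> \sum_(i < j') d i < \sum_(i < j) d i).
Proof.
move=> jn j'n neg pos.
suff H : j != j' -> \sum_(i < j') d i < \sum_(i < j) d i.
  by split => //; have [->|/H/ltW] := eqVneq j j'.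
rewrite -!(big_mkord xpredT d) neq_ltn => /orP[jj'|jj'].
  rewrite (@big_cat_nat _ _ _ j 0 j')//=; last exact: ltnW.
  rewrite gtrDl -oppr_gt0 -sumrN.
  rewrite big_ltn//; apply: ltr_pwDl; first by rewrite oppr_gt0 neg ?(leq_trans jj').
  rewrite big_nat; apply: sumr_ge0 => i /andP[_ ij'].
  by rewrite oppr_ge0 ltW// neg// (leq_trans ij').
rewrite (@big_cat_nat _ _ _ j' 0 j)//=; last exact: ltnW.
rewrite ltrDl big_ltn//; apply: ltr_pwDl; first by rewrite pos ?(leq_trans jj').
rewrite big_nat; apply: sumr_ge0 => i /andP[j'i ij].
by rewrite ltW// pos//; [exact: leq_trans jn|exact: ltnW].
Qed.

(* phi and psi are the multipliers of the location and job constraints: they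
   accumulate the cost increments along the staircase of switching times, so
   that the increment at a switching time is exactly compensated. *)
Lemma dual_potentials (R : realDomainType) (c : nat -> nat -> R -> R) (J K : nat)
    (a b : nat -> R) (t0 : R) :
  (forall i k k' s, (i < J)%N -> (k <= k' <= K)%N -> s <= t0 ->
    diff1 c i k' s <= diff1 c i k s) ->
  (forall j j' m s, (m < K)%N -> (j <= j' <= J)%N -> s <= t0 ->
    diff2 c j' m s <= diff2 c j m s) ->
  (forall i k s s', (i < J)%N -> (k <= K)%N -> s < s' -> s' <= t0 ->
    diff1 c i k s' < diff1 c i k s) ->
  (forall j m s s', (j <= J)%N -> (m < K)%N -> s < s' -> s' <= t0 ->
    diff2 c j m s' < diff2 c j m s) ->
  {in [pred i | (i < J)%N] &, {homo a : i i' / (i <= i')%N >-> i <= i'}} ->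
  {in [pred m | (m < K)%N] &, {homo b : m m' / (m <= m')%N >-> m <= m'}} ->
  (forall i, (i < J)%N -> a i <= t0) -> (forall m, (m < K)%N -> b m <= t0) ->
  exists phi psi : nat -> R,
    [/\ phi 0%N = 0, psi 0%N = 0 &
    forall s j' k', s <= t0 -> (j' <= J)%N -> (k' <= K)%N ->
      (forall i, (i < J)%N -> if (i < j')%N then a i < s else s < a i) ->
      (forall m, (m < K)%N -> if (m < k')%N then b m < s else s < b m) ->
      forall j k, (j <= J)%N -> (k <= K)%N -> (j, k) != (j', k') ->
      c j' k' s - phi j' - psi k' < c j k s - phi j - psi k].
Proof.
move=> sub1 sub2 dec1 dec2 ah bh a0 b0.
(* [kk i] is the job active when location [i] is left, and [jj m] below is the location active when
   job [m] is left. Simultaneous switches are ordered by pairing a strict with a weak inequality, so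
   that both thresholds describe the same staircase. *)
have /choice[kk kkP] : forall i, exists kk, (i < J)%N ->
    (kk <= K)%N /\ forall m, (m < K)%N -> (m < kk)%N = (b m < a i).
  move=> i; have [iJ|] := ltnP i J; last by exists 0%N.
  have [|kk kkK kkP] := @initial_segment_bound (fun m => b m < a i) K.
    move=> m m' /andP[mm' m'K]; apply: le_lt_trans; apply: bh => //.
    by rewrite inE (leq_ltn_trans mm').
  by exists kk.
have /choice[jj jjP] : forall m, exists jj, (m < K)%N ->
    (jj <= J)%N /\ forall i, (i < J)%N -> (i < jj)%N = (a i <= b m).
  move=> m; have [mK|] := ltnP m K; last by exists 0%N.
  have [|jj jjJ jjP] := @initial_segment_bound (fun i => a i <= b m) J.
    move=> i i' /andP[ii' i'J]; apply: le_trans; apply: ah => //.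
    by rewrite inE (leq_ltn_trans ii').
  by exists jj.
have kj i m : (i < J)%N -> (m < K)%N -> (m < kk i)%N = ~~ (i < jj m)%N.
  move=> iJ mK; have [_ ->//] := kkP _ iJ; have [_ ->//] := jjP _ mK.
  by rewrite ltNge.
exists (fun j => \sum_(i < j) diff1 c i (kk i) (a i)).
exists (fun k => \sum_(m < k) diff2 c (jj m) m (b m)).
rewrite !big_ord0; split => // s j' k' s0 j'J k'K aP bP j k jJ kK jk.
(* [d] and [e] compare an increment at time [s] with its value at its own switching time.
   Monotonicity in time makes them negative exactly when that switch is past. *)
pose d i := diff1 c i (kk i) s - diff1 c i (kk i) (a i).
pose e m := diff2 c (jj m) m s - diff2 c (jj m) m (b m).
have [dle dlt] : (\sum_(i < j') d i <= \sum_(i < j) d i) /\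
  (j != j' -> \sum_(i < j') d i < \sum_(i < j) d i).
  apply: (@sum_initial_le _ d J) => // i iJ ij'; have [kkK _] := kkP _ iJ;
    have := aP _ iJ.
    by rewrite ij' => ais; rewrite subr_lt0 dec1.
  by rewrite ltnNge ij'/= => sai; rewrite subr_gt0 dec1 ?a0.
have [ele elt] : (\sum_(m < k') e m <= \sum_(m < k) e m) /\
  (k != k' -> \sum_(m < k') e m < \sum_(m < k) e m).
  apply: (@sum_initial_le _ e K) => // m mK mk'; have [jjJ _] := jjP _ mK;
    have := bP _ mK.
    by rewrite mk' => bms; rewrite subr_lt0 dec2.
  by rewrite ltnNge mk'/= => sbm; rewrite subr_gt0 dec2 ?b0.
have sumB N (u v : nat -> R) :
    \sum_(i < N) (u i - v i) = \sum_(i < N) u i - \sum_(i < N) v i.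
  exact: sumrB.
have E n p : (n <= J)%N -> (p <= K)%N -> c n p s - \sum_(i < n) diff1 c i (kk i) (a i)
    - \sum_(m < p) diff2 c (jj m) m (b m) = c 0%N 0%N s
    + (\sum_(i < n) (diff1 c i (minn p (kk i)) s - diff1 c i (kk i) (a i))
     + \sum_(m < p) (diff2 c (minn n (jj m)) m s - diff2 c (jj m) m (b m))).
  move=> nJ pK.
  rewrite (sumB n (fun i => diff1 c i (minn p (kk i)) s) (fun i => diff1 c i (kk i) (a i))).
  rewrite (sumB p (fun m => diff2 c (minn n (jj m)) m s) (fun m => diff2 c (jj m) m (b m))).
  move: (staircase_telescope c s kj nJ pK) => /eqP; rewrite subr_eq => /eqP ->.
  by ring.
rewrite !E// ltrD2l.
(* At the served pair the caps are idle: [k' < kk i] with [i < j'] would put the switch [b k']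
   before [a i], hence before [s], although job [k'] is still being served. *)
have -> : \sum_(i < j') (diff1 c i (minn k' (kk i)) s - diff1 c i (kk i) (a i)) =
          \sum_(i < j') d i.
  apply: eq_bigr => i _; have iJ : (i < J)%N by exact: leq_trans j'J.
  have [kkK kkE] := kkP _ iJ; have := aP _ iJ; rewrite ltn_ord => ais.
  rewrite (minn_idPr _)//; rewrite leqNgt; apply/negP => k'kk.
  have k'K' := leq_trans k'kk kkK.
  move: k'kk; rewrite kkE// => ba; have := bP _ k'K'; rewrite ltnn => sb.
  by have := lt_trans (lt_trans ba ais) sb; rewrite ltxx.
have -> : \sum_(m < k') (diff2 c (minn j' (jj m)) m s - diff2 c (jj m) m (b m)) =
          \sum_(m < k') e m.
  apply: eq_bigr => m _; have mK : (m < K)%N by exact: leq_trans k'K.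
  have [jjJ jjE] := jjP _ mK; have := bP _ mK; rewrite ltn_ord => bms.
  rewrite (minn_idPr _)//; rewrite leqNgt; apply/negP => j'jj.
  have j'J' := leq_trans j'jj jjJ.
  move: j'jj; rewrite jjE// => ab; have := aP _ j'J'; rewrite ltnn => sa.
  by have := lt_trans (le_lt_trans ab bms) sa; rewrite ltxx.
(* For any other pair the cap lowers the job index, which by submodularity cannot lower the
   increment. *)
have le1 : \sum_(i < j) d i <=
    \sum_(i < j) (diff1 c i (minn k (kk i)) s - diff1 c i (kk i) (a i)).
  apply: ler_sum => i _; rewrite lerD2r.
  have iJ : (i < J)%N by exact: leq_trans jJ.
  by have [kkK _] := kkP _ iJ; apply: sub1 => //; rewrite geq_minr.
have le2 : \sum_(m < k) e m <=
    \sum_(m < k) (diff2 c (minn j (jj m)) m s - diff2 c (jj m) m (b m)).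
  apply: ler_sum => m _; rewrite lerD2r.
  have mK : (m < K)%N by exact: leq_trans kK.
  by have [jjJ _] := jjP _ mK; apply: sub2 => //; rewrite geq_minr.
apply: lt_le_trans (lerD le1 le2).
move: jk; rewrite xpair_eqE negb_and => /orP[jj'|kk'].
  by apply: ltr_leD => //; exact: dlt.
by apply: ler_ltD => //; exact: elt.
Qed.

(** * Sign of the reduced gap at a fixed time *)

Section pointwise_gap.
Context (R : realDomainType) (I : finType) (r x y : I -> R) (C mu : R).
Hypothesis y_ge0 : forall i, 0 <= y i.

(** Complementary slackness: as [x] uses the full capacity on [p], the gap is the excess cost of the
    flow outside [p] plus the capacity price [C - r p] times the capacity that [y] leaves idle. Both
    are nonnegative, and if both vanish then [y] is concentrated on [p] at level [mu]. *)
Lemma gap_of_active (p : I) :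
  (forall q, q != p -> r p < r q) -> r p < C ->
  \sum_i y i <= mu -> (forall q, x q = if q == p then mu else 0) ->
  0 <= \sum_i (r i - C) * (y i - x i) /\
  (\sum_i (r i - C) * (y i - x i) = 0 -> forall i, y i = x i).
Proof.
move=> rp rC ymu xE.
have -> : \sum_i (r i - C) * (y i - x i) =
    \sum_i (r i - r p) * y i + (C - r p) * (mu - \sum_i y i).
  have sx : \sum_i x i = mu.
    by rewrite (bigD1 p)//= xE eqxx big1 ?addr0// => i ip; rewrite xE (negbTE ip).
  rewrite -{1}sx -sumrB mulr_sumr -big_split/=; apply: eq_bigr => i _.
  rewrite xE; case: (eqVneq i p) => [->|_]; last by ring.
  by ring.
have t1 i : 0 <= (r i - r p) * y i.
  have [->|/rp/ltW ip] := eqVneq i p; first by rewrite subrr mul0r.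
  by rewrite mulr_ge0// subr_ge0.
have s1 : 0 <= \sum_i (r i - r p) * y i by apply: sumr_ge0 => i _.
have s2 : 0 <= (C - r p) * (mu - \sum_i y i) by rewrite mulr_ge0// subr_ge0// ltW.
split; first exact: addr_ge0.
move=> /eqP; rewrite paddr_eq0// => /andP[/eqP z1 /eqP z2].
have y0 i : i != p -> y i = 0.
  move=> ip; have /eqP := psumr_eq0P (fun i _ => t1 i) z1 (erefl true) : (r i - r p) * y i = 0.
  by rewrite mulf_eq0 subr_eq0 gt_eqF ?rp//= => /eqP.
move: z2 => /eqP; rewrite mulf_eq0 !subr_eq0 gt_eqF//= => /eqP muE i.
rewrite xE; case: (eqVneq i p) => [->|/y0//].
by rewrite muE (bigD1 p)//= big1 ?addr0.
Qed.

Lemma gap_of_inactive : (forall i, C < r i) -> (forall i, x i = 0) ->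
  0 <= \sum_i (r i - C) * (y i - x i) /\
  (\sum_i (r i - C) * (y i - x i) = 0 -> forall i, y i = x i).
Proof.
move=> rC x0.
have t i : 0 <= (r i - C) * (y i - x i).
  by rewrite x0 subr0 mulr_ge0// subr_ge0 ltW.
split; first by apply: sumr_ge0 => i _.
move=> z i; have /eqP := psumr_eq0P (fun i _ => t i) z (erefl true) : (r i - C) * (y i - x i) = 0.
by rewrite mulf_eq0 subr_eq0 gt_eqF//= subr_eq0 => /eqP.
Qed.

End pointwise_gap.

(** * Integrability from an integrable lower bound *)

Section ae_lower_bound.
Local Open Scope ereal_scope.
Context d (T : measurableType d) (R : realType) (mu : {measure set T -> \bar R}).
Variables (D : set T) (mD : measurable D) (u f : T -> \bar R).
Hypotheses (mf : measurable_fun D f) (iu : mu.-integrable D u).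
Hypothesis uf : {ae mu, forall x, D x -> u x <= f x}.

Let integral_funeneg_lty : \int[mu]_(x in D) f^\- x < +oo.
Proof.
have /integrableP[um uoo] := iu.
apply: le_lt_trans uoo; apply: ae_ge0_le_integral => //.
- exact: measurable_funeneg.
- exact: measurableT_comp.
- apply: filterS uf => x + Dx => /(_ Dx) ufx.
  rewrite funenegE ge_max abse_ge0 andbT.
  (* The negative part of [f] is dominated by the absolute value of [u]. *)
  by apply: le_trans (_ : - u x <= _); rewrite ?leeN2// -abseN lee_abs.
Qed.

Lemma ntlt_integral_of_ae_ge : -oo < \int[mu]_(x in D) f x.
Proof.
rewrite integralE; have := integral_funeneg_lty.
have : 0 <= \int[mu]_(x in D) f^\+ x by exact: integral_ge0.
have : 0 <= \int[mu]_(x in D) f^\- x by exact: integral_ge0.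
by case: (\int[mu]_(x in D) f^\- x) => //; case: (\int[mu]_(x in D) f^\+ x) => //= *; exact: ltNyr.
Qed.

Lemma integrable_of_ae_ge : \int[mu]_(x in D) f x < +oo -> mu.-integrable D f.
Proof.
move=> foo; apply/integrableP; split => //.
rewrite -[fun x => _]/(abse \o f) fune_abse ge0_integralD//; last 2 first.
- exact: measurable_funepos.
- exact: measurable_funeneg.
apply: lte_add_pinfty; last exact: integral_funeneg_lty.
move: foo; rewrite integralE; have := integral_funeneg_lty.
have : 0 <= \int[mu]_(x in D) f^\- x by exact: integral_ge0.
case: (\int[mu]_(x in D) f^\- x) => // r _ _.
by case: (\int[mu]_(x in D) f^\+ x) => //= *; exact: ltry.
Qed.

End ae_lower_bound.

(** A summand [-oo] would absorb [+oo]; only once it is excluded does a bound on the sum bound each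
    term. *)
Lemma lty_summand (R : realDomainType) (I : finType) (F : I -> \bar R) :
  (forall i, (-oo < F i)%E) -> ((\sum_i F i)%R < +oo)%E -> forall i, (F i < +oo)%E.
Proof.
move=> F_ltNy; have F_neq i : F i != -oo%E by rewrite gt_eqF.
rewrite !ltey esum_eqy; last by move=> i _; exact: F_neq.
by move=> H i; rewrite ltey; apply: contra H => Fi; apply/existsP; exists i.
Qed.

Lemma eq_of_ler_sum (R : numDomainType) (I : finType) (a b : I -> R) :
  (forall i, a i <= b i) -> \sum_i b i <= \sum_i a i -> forall i, a i = b i.
Proof.
move=> ab ba i; apply/esym/eqP; rewrite -subr_eq0.
have d0 j : 0 <= b j - a j by rewrite subr_ge0.
rewrite (psumr_eq0P (P := predT) (F := fun j => b j - a j))//.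
by apply/eqP; rewrite eq_le sumr_ge0 ?andbT// sumrB subr_le0.
Qed.

Lemma ae_onS (R : realType) (S : set R) (P Q : R -> Prop) :
  (forall s, S s -> P s -> Q s) -> ae_on S P -> ae_on S Q.
Proof.
move=> PQ; have F := ae_filter_ringOfSetsType (@lebesgue_measure R).
by rewrite /ae_on; apply: filterS => s + Ss => /(_ Ss); exact: PQ.
Qed.

Lemma ae_onS2 (R : realType) (S : set R) (P P' Q : R -> Prop) :
  (forall s, S s -> P s -> P' s -> Q s) -> ae_on S P -> ae_on S P' -> ae_on S Q.
Proof.
move=> PQ; have F := ae_filter_ringOfSetsType (@lebesgue_measure R).
rewrite /ae_on; apply: filterS2 => s + + Ss => /(_ Ss) + /(_ Ss).
exact: PQ.
Qed.

Lemma Rintegral_sum d (T : measurableType d) (R : realType)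
    (m : {measure set T -> \bar R}) (D : set T) (I : finType) (F : I -> T -> R) :
  measurable D -> (forall i, m.-integrable D (EFin \o F i)) ->
  Rintegral m D (fun t => \sum_i F i t) = \sum_i Rintegral m D (F i).
Proof.
move=> mD iF; rewrite /Rintegral.
under eq_integral do rewrite -sumEFin.
rewrite (integral_sum mD iF) (eq_bigr (fun i => (Rintegral m D (F i))%:E)).
  by rewrite sumEFin.
move=> i _; rewrite /Rintegral fineK//.
exact: (integrable_fin_num mD (iF i)).
Qed.

(** * Optimality and uniqueness from a nonnegative reduced gap *)

Section duality.
Context (R : realType) (J K : nat).
Notation leb := (@lebesgue_measure R).
Notation integral S h := (Rintegral leb S h).
Variables (S : set R) (mu : R) (Rj : 'I_J.+1 -> R) (Qk : 'I_K.+1 -> R).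
Variables (c : 'I_J.+1 -> 'I_K.+1 -> R -> R) (B : 'I_J.+1 -> 'I_K.+1 -> R).
Hypotheses (mS : measurable S) (mc : forall j k, measurable_fun S (c j k)).
Hypothesis c_ge : forall j k s, - B j k <= c j k s.
Hypothesis sum_eq : \sum_j Rj j = \sum_k Qk k.

Let chat j k s : \bar R := if s <= 0 then (c j k s)%:E else +oo%E.

Lemma flow_integrable (y : flow R J K) : feasible S mu Rj Qk y ->
  forall j k, leb.-integrable S (EFin \o y j k).
Proof.
move=> [my y0 _ yR _] j k.
have i0 := integrable0 leb S.
have yge k' : {ae leb, forall s, S s -> ((fun=> 0%E) s <= (EFin \o y j k') s)%E}.
  by apply: ae_onS (y0 j k') => s _; rewrite /= lee_fin.
have my' k' : measurable_fun S (EFin \o y j k') by exact/measurable_EFinP.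
apply: (integrable_of_ae_ge (mu := leb) mS (my' k) i0 (yge k)).
apply: (lty_summand (F := fun k' => (\int[leb]_(s in S) (y j k' s)%:E)%E)) => [k'|].
  exact: (ntlt_integral_of_ae_ge (mu := leb) mS (my' k') i0 (yge k')).
by apply: le_lt_trans (yR j) _; rewrite ltry.
Qed.

Lemma integral_flow_fine (y : flow R J K) : feasible S mu Rj Qk y ->
  forall j k, (\int[leb]_(s in S) (y j k s)%:E)%E = (integral S (y j k))%:E.
Proof.
move=> fy j k; rewrite /Rintegral fineK//.
exact: (integrable_fin_num (mu := leb) mS (flow_integrable fy j k)).
Qed.

Lemma flow_tight (y : flow R J K) : feasible S mu Rj Qk y ->
  (forall j, \sum_k integral S (y j k) = Rj j) /\
  (forall k, \sum_j integral S (y j k) = Qk k).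
Proof.
move=> fy; have [_ _ _ yR yQ] := fy.
have leR j : \sum_k integral S (y j k) <= Rj j.
  move: (yR j); under eq_bigr do rewrite integral_flow_fine//.
  by rewrite sumEFin lee_fin.
have geQ k : Qk k <= \sum_j integral S (y j k).
  move: (yQ k); under eq_bigr do rewrite integral_flow_fine//.
  by rewrite sumEFin lee_fin.
have sR := ler_sum _ (fun j _ => leR j); have sQ := ler_sum _ (fun k _ => geQ k).
split=> [j|k].
  apply: (eq_of_ler_sum leR); rewrite sum_eq exchange_big/=; exact: ler_sum.
apply/esym; apply: (eq_of_ler_sum geQ); rewrite -sum_eq exchange_big/=; exact: ler_sum.
Qed.

Let wcost (y : flow R J K) j k s := c j k s * y j k s.

Let chat_eq (y : flow R J K) j k :
  ae_on S (fun s => 0 < s -> y j k s = 0) ->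
  ae_on S (fun s => (chat j k s * (y j k s)%:E = (wcost y j k s)%:E)%E).
Proof.
apply: ae_onS => s _; rewrite /chat /wcost.
by case: (leP s 0) => [_ _|s0 ->//]; rewrite ?mule0 ?mulr0// EFinM.
Qed.

Let m_chat (y : flow R J K) j k : feasible S mu Rj Qk y ->
  measurable_fun S (fun s => (chat j k s * (y j k s)%:E)%E).
Proof.
move=> [my _ _ _ _]; apply: emeasurable_funM; last exact/measurable_EFinP.
apply: measurable_fun_if => //.
- apply: (@measurable_funS _ _ _ _ setT) => //; apply: measurable_fun_ler => //.
- apply: (@measurable_funS _ _ _ _ S) => //; exact/measurable_EFinP.
Qed.

Let m_wcost (y : flow R J K) j k : feasible S mu Rj Qk y ->
  measurable_fun S (EFin \o wcost y j k).
Proof.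
by move=> [my _ _ _ _]; apply/measurable_EFinP; exact: measurable_funM.
Qed.

Let integral_chat (y : flow R J K) j k : feasible S mu Rj Qk y ->
  ae_on S (fun s => 0 < s -> y j k s = 0) ->
  (\int[leb]_(s in S) (chat j k s * (y j k s)%:E) =
   \int[leb]_(s in S) (wcost y j k s)%:E)%E.
Proof.
move=> fy y0; apply: ae_eq_integral => //.
- exact: m_chat.
- exact: m_wcost.
- exact: chat_eq.
Qed.

(** The lower bound is integrable because the flow is, so no cost integral equals [-oo], and a
    finite total makes each of them finite. *)
Let chat_ge (y : flow R J K) j k : feasible S mu Rj Qk y ->
  ae_on S (fun s => ((- B j k)%:E * (y j k s)%:E <= chat j k s * (y j k s)%:E)%E).
Proof.
move=> [_ y0 _ _ _]; apply: ae_onS (y0 j k) => s _ ys.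
apply: lee_wpmul2r; rewrite ?lee_fin// /chat.
by case: ifP => _; rewrite ?lee_fin ?leey.
Qed.

Lemma finite_objective (y : flow R J K) : feasible S mu Rj Qk y ->
  (objective S chat y < +oo)%E -> forall j k,
  ae_on S (fun s => 0 < s -> y j k s = 0) /\ leb.-integrable S (EFin \o wcost y j k).
Proof.
move=> fy foo j k.
have iB j' k' : leb.-integrable S (fun s => (- B j' k')%:E * (y j' k' s)%:E)%E.
  exact: integrableZl (flow_integrable fy j' k').
have gtNy j' k' := ntlt_integral_of_ae_ge (mu := leb) mS (m_chat j' k' fy) (iB j' k')
  (chat_ge j' k' fy).
have ltoo : (\int[leb]_(s in S) (chat j k s * (y j k s)%:E) < +oo)%E.
  apply: (lty_summand (gtNy j)).
  apply: (lty_summand (F := fun j =>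
    (\sum_k \int[leb]_(s in S) (chat j k s * (y j k s)%:E))%E)) foo j => j'.
  rewrite ltNye esum_eqNy; apply/existsP => -[k' /andP[_ /eqP E]].
  by have := gtNy j' k'; rewrite E.
have ichat := integrable_of_ae_ge (mu := leb) mS (m_chat j k fy) (iB j k) (chat_ge j k fy) ltoo.
have y0 : ae_on S (fun s => 0 < s -> y j k s = 0).
  (* An integrable function is finite almost everywhere, while [+oo] times a positive flow is
     not. *)
  have := integrable_ae (mu := leb) mS ichat.
  have [_ yge _ _ _] := fy.
  apply: ae_onS2 (yge j k) => s Ss ys + s0.
  rewrite /chat leNgt s0/= => H.
  apply/eqP; rewrite eq_le ys andbT leNgt; apply/negP => ys0.
  by move: H; rewrite gt0_mulye ?lte_fin.
split=> //.
apply: (integrable_of_ae_ge (mu := leb) mS (m_wcost j k fy) (iB j k)).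
  by apply: ae_onS2 (chat_ge j k fy) (chat_eq y0) => s _ H E; rewrite /= -E.
by rewrite -integral_chat.
Qed.

Let objective_fine (y : flow R J K) : feasible S mu Rj Qk y ->
  (objective S chat y < +oo)%E ->
  objective S chat y = (\sum_j \sum_k integral S (wcost y j k))%:E.
Proof.
move=> fy foo; rewrite /objective -sumEFin; apply: eq_bigr => j _.
rewrite -sumEFin; apply: eq_bigr => k _.
have [y0 iw] := finite_objective fy foo j k.
rewrite (integral_chat fy y0) /Rintegral fineK//.
exact: (integrable_fin_num (mu := leb) mS iw).
Qed.

Variables (x : flow R J K) (phi : 'I_J.+1 -> R) (psi : 'I_K.+1 -> R) (C : R).

(** The difference of the Lagrangians of [y] and [x]. Subtracting [C] does not change its integral,
    since feasible flows have equal totals, but it gives the integrand a sign. *)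
Definition reduced_gap (y : flow R J K) (s : R) : R :=
  \sum_j \sum_k (c j k s - phi j - psi k - C) * (y j k s - x j k s).

Hypotheses (fx : feasible S mu Rj Qk x) (x_foo : (objective S chat x < +oo)%E).
Hypothesis gap : forall y, feasible S mu Rj Qk y ->
  (forall j k, ae_on S (fun s => 0 < s -> y j k s = 0)) ->
  ae_on S (fun s => 0 <= reduced_gap y s /\
    (reduced_gap y s = 0 -> forall j k, y j k s = x j k s)).

(** The cost [c] need not be integrable against an arbitrary difference of flows; [wcost] is
    integrable for each flow of finite cost. This grouping makes linearity of the integral
    available. *)
Let gap_term (y : flow R J K) j k s :=
  wcost y j k s - wcost x j k s - (phi j + psi k + C) * (y j k s - x j k s).

Let gap_sum (y : flow R J K) : reduced_gap y = fun s => \sum_j \sum_k gap_term y j k s.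
Proof.
apply/funext => s; apply: eq_bigr => j _; apply: eq_bigr => k _.
by rewrite /gap_term /wcost; ring.
Qed.

Let integrable_gap_term (y : flow R J K) : feasible S mu Rj Qk y ->
  (objective S chat y < +oo)%E -> forall j k,
  leb.-integrable S (EFin \o gap_term y j k) /\
  integral S (gap_term y j k) = integral S (wcost y j k) - integral S (wcost x j k)
    - (phi j + psi k + C) * (integral S (y j k) - integral S (x j k)).
Proof.
move=> fy foo j k.
have [_ iy] := finite_objective fy foo j k.
have [_ ix] := finite_objective fx x_foo j k.
have fiy := flow_integrable fy j k; have fix_ := flow_integrable fx j k.
have id1 := integrableB (mu := leb) mS iy ix.
have id2 := integrableB (mu := leb) mS fiy fix_.
have id3 := integrableZl (mu := leb) mS (phi j + psi k + C) id2.
split; first exact: (integrableB (mu := leb) mS id1 id3).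
rewrite (RintegralB (mu := leb) mS id1 id3) (RintegralB (mu := leb) mS iy ix).
by rewrite (RintegralZl (mu := leb) _ mS id2) (RintegralB (mu := leb) mS fiy fix_).
Qed.

Let integral_gap (y : flow R J K) : feasible S mu Rj Qk y ->
  (objective S chat y < +oo)%E ->
  leb.-integrable S (EFin \o reduced_gap y) /\
  objective S chat y = (objective S chat x + (integral S (reduced_gap y))%:E)%E.
Proof.
move=> fy foo; have ig := integrable_gap_term fy foo.
have igj j : leb.-integrable S (EFin \o (fun s => \sum_k gap_term y j k s)).
  rewrite (_ : _ \o _ = fun s => (\sum_k (EFin \o gap_term y j k) s)%E).
    by apply: (integrable_sum (mu := leb) mS) => k _; have [] := ig j k.
  by apply/funext => s; rewrite /= sumEFin.
split.
  rewrite gap_sum (_ : _ \o _ = fun s =>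
    (\sum_j (EFin \o (fun s => \sum_k gap_term y j k s)%R) s)%E).
    by apply: (integrable_sum (mu := leb) mS) => j _.
  by apply/funext => s; rewrite /= sumEFin.
rewrite (objective_fine fy foo) (objective_fine fx x_foo) -EFinD; congr EFin.
rewrite gap_sum (Rintegral_sum (m := leb) mS igj).
have -> : \sum_j integral S (fun s => \sum_k gap_term y j k s) =
    \sum_j \sum_k integral S (gap_term y j k).
  by apply: eq_bigr => j _; apply: (Rintegral_sum (m := leb) mS) => k; have [] := ig j k.
have [yR yQ] := flow_tight fy; have [xR xQ] := flow_tight fx.
pose dy j k := integral S (y j k) - integral S (x j k).
have dR j : \sum_k dy j k = 0 by rewrite sumrB yR xR subrr.
have dQ k : \sum_j dy j k = 0 by rewrite sumrB yQ xQ subrr.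
(* [phi j + C] meets the row sums of [dy] and [psi k] its column sums, all of which are zero by
   tightness. *)
have z : \sum_j \sum_k (phi j + psi k + C) * dy j k = 0.
  have -> : \sum_j \sum_k (phi j + psi k + C) * dy j k =
      \sum_j (phi j + C) * \sum_k dy j k + \sum_k psi k * \sum_j dy j k.
    have -> : \sum_k psi k * \sum_j dy j k = \sum_j \sum_k psi k * dy j k.
      by rewrite exchange_big/=; apply: eq_bigr => k _; rewrite mulr_sumr.
    rewrite -big_split/=; apply: eq_bigr => j _.
    by rewrite mulr_sumr -big_split/=; apply: eq_bigr => k _; ring.
  by rewrite !big1 ?addr0// => [k _|j _]; rewrite ?dQ ?dR mulr0.
have -> : \sum_j \sum_k integral S (gap_term y j k) =
    \sum_j \sum_k (integral S (wcost y j k) - integral S (wcost x j k))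
    - \sum_j \sum_k (phi j + psi k + C) * dy j k.
  rewrite -sumrB; apply: eq_bigr => j _; rewrite -sumrB.
  by apply: eq_bigr => k _; have [_ ->] := ig j k.
have -> : \sum_j \sum_k (integral S (wcost y j k) - integral S (wcost x j k)) =
    \sum_j \sum_k integral S (wcost y j k) - \sum_j \sum_k integral S (wcost x j k).
  by rewrite -sumrB; apply: eq_bigr => j _; rewrite sumrB.
by rewrite z subr0 addrC subrK.
Qed.

Let finite_ae0 (y : flow R J K) : feasible S mu Rj Qk y ->
  (objective S chat y < +oo)%E ->
  ae_on S (fun s => 0 <= reduced_gap y s /\
    (reduced_gap y s = 0 -> forall j k, y j k s = x j k s)).
Proof.
by move=> fy foo; apply: gap => // j k; have [] := finite_objective fy foo j k.
Qed.

Let integral_gap_abs (y : flow R J K) : feasible S mu Rj Qk y ->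
  (objective S chat y < +oo)%E ->
  (integral S (reduced_gap y))%:E = (\int[leb]_(s in S) `|(reduced_gap y s)%:E|)%E.
Proof.
move=> fy foo; have [iw _] := integral_gap fy foo.
have mw := measurable_int leb iw.
rewrite /Rintegral fineK ?(integrable_fin_num (mu := leb) mS iw)//.
apply: ae_eq_integral => //; first exact: measurableT_comp.
by apply: ae_onS (finite_ae0 fy foo) => s _ [w0 _]; rewrite /= ger0_norm.
Qed.

Theorem solution_of_reduced_gap :
  is_solution S mu Rj Qk chat x /\
  forall y, is_solution S mu Rj Qk chat y ->
    forall j k, ae_on S (fun s => y j k s = x j k s).
Proof.
split.
  split=> // y fy; have [->|foo] := eqVneq (objective S chat y) +oo%E; first exact: leey.
  rewrite -ltey in foo; have [_ ->] := integral_gap fy foo.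
  by rewrite leeDl// integral_gap_abs// integral_ge0.
move=> y [fy ymin] j k.
have foo : (objective S chat y < +oo)%E by apply: le_lt_trans x_foo; exact: ymin.
have [iw E] := integral_gap fy foo.
(* Optimality of [y] against [x] makes the integral of the gap nonpositive; being nonnegative almost
   everywhere, the gap then vanishes almost everywhere. *)
have w0 : (\int[leb]_(s in S) `|(reduced_gap y s)%:E|)%E = 0%E.
  rewrite -integral_gap_abs//; apply/eqP; rewrite eqe; apply/eqP/le_anti/andP; split.
    by move: (ymin _ fx); rewrite E (objective_fine fx x_foo) -EFinD lee_fin gerDl.
  by rewrite -lee_fin integral_gap_abs// integral_ge0.
have /(ae_eq_integral_abs leb mS (measurable_int leb iw)) {}w0 := w0.
apply: ae_onS2 (finite_ae0 fy foo) w0 => s _ [_ gapE] /= [w0].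
exact: gapE.
Qed.

End duality.

(** * Mixed differences of a joint cumulative function *)

Lemma big_telescope_lt (R : zmodType) (u : nat -> R) (N n : nat) : (n <= N)%N ->
  \sum_(j < N | (j < n)%N) (u j.+1 - u j) = u n - u 0%N.
Proof.
move=> nN; rewrite -(big_ord_widen _ (fun j => u j.+1 - u j) nN).
by rewrite -(big_mkord xpredT (fun j => u j.+1 - u j)) telescope_sumr.
Qed.

(** The mass that a joint cumulative function [V] assigns to the cell [(j,k)], by inclusion and
    exclusion. *)
Definition mixed_diff (R : zmodType) (V : nat -> nat -> R) (j k : nat) : R :=
  (V j.+1 k.+1 - V j k.+1) - (V j.+1 k - V j k).

Lemma sum_mixed_diff (R : zmodType) (V : nat -> nat -> R) (j M m : nat) :
  (m <= M)%N -> \sum_(k < M | (k < m)%N) mixed_diff V j k =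
  (V j.+1 m - V j m) - (V j.+1 0%N - V j 0%N).
Proof. exact: (@big_telescope_lt _ (fun k => V j.+1 k - V j k)). Qed.

Lemma sum_sum_mixed_diff (R : zmodType) (V : nat -> nat -> R) (N M n m : nat) :
  (n <= N)%N -> (m <= M)%N ->
  \sum_(j < N | (j < n)%N) \sum_(k < M | (k < m)%N) mixed_diff V j k =
  (V n m - V n 0%N) - (V 0%N m - V 0%N 0%N).
Proof.
move=> nN mM.
transitivity (\sum_(j < N | (j < n)%N) ((V j.+1 m - V j.+1 0%N) - (V j m - V j 0%N))).
  apply: eq_bigr => j _; rewrite sum_mixed_diff//.
  by rewrite opprB opprB addrACA [RHS]addrACA; congr (_ + _); rewrite addrC.
by rewrite (big_telescope_lt (fun j => V j m - V j 0%N)).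
Qed.

(* Both sides are the length of the intersection of ]-oo, s], ]a, a'] and ]b, b']. *)
Lemma overlap_mixed_diff (R : realFieldType) (a a' b b' s : R) :
  a <= a' -> b <= b' ->
  Num.max 0 (Num.min s (Num.min a' b') - Num.max a b) =
  (Num.min s (Num.min a' b') - Num.min s (Num.min a b'))
  - (Num.min s (Num.min a' b) - Num.min s (Num.min a b)).
Proof.
wlog ab : a a' b b' / a <= b.
  move=> wlog aa' bb'; have /orP[ab|ba] := le_total a b; first exact: wlog.
  rewrite (minC a') (maxC a) (wlog b b' a a')// (minC b' a) (minC b a) (minC b a').
  ring.
move=> aa' bb'; rewrite (max_r ab) (min_l ab) (min_l (le_trans ab bb')).
have /orP[sb|bs] := le_total s b.
  rewrite !(minCA s a') (min_l (le_trans sb bb')) (min_l sb) subrr max_l//.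
  by rewrite subr_le0 ge_min sb orbT.
rewrite (min_r (le_trans ab bs)).
have /orP[a'b|ba'] := le_total a' b.
  rewrite (min_l a'b) (min_l (le_trans a'b bb')) (min_r (le_trans a'b bs)).
  rewrite max_l; last by rewrite subr_le0.
  by rewrite !subrr.
rewrite (min_r ba') (min_r bs) max_r; first ring.
by rewrite subr_ge0 !le_min ba' bb' bs.
Qed.

(** * The sorted flow and its integrals *)

Section sorted_flow.
Context (R : realType) (J K : nat) (a b : nat -> R) (T mu : R).
Notation leb := (@lebesgue_measure R).
Hypotheses (a_homo : {homo a : i j / (i <= j)%N >-> i <= j}).
Hypotheses (b_homo : {homo b : i j / (i <= j)%N >-> i <= j}).
Hypotheses (a0 : a 0%N = - T) (b0 : b 0%N = - T) (aJ : a J.+1 = 0) (bK : b K.+1 = 0).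
Hypothesis mu_ge0 : 0 <= mu.

(** Locations and jobs are each served in increasing order, with switching times [a] and [b]. Strict
    inequalities keep two pairs from being active at once; the switching times left unserved form a
    null set. *)
Definition sorted_flow : flow R J K := fun j k s =>
  if [&& a j < s, b k < s, s < a j.+1 & s < b k.+1] then mu else 0.

Let I (j k : nat) : set R :=
  `]Num.max (a j) (b k), Num.min (a j.+1) (b k.+1)[%classic.

Let sorted_flowE j k s : sorted_flow j k s = mu * \1_(I j k) s.
Proof.
rewrite /sorted_flow indicE /I; case: ifPn => [H|H].
  by rewrite mem_set ?mulr1//= in_itv/= gt_max lt_min -andbA.
rewrite memNset ?mulr0//= in_itv/= gt_max lt_min -andbA.
exact/negP.
Qed.

Lemma sorted_flow_ge0 j k s : 0 <= sorted_flow j k s.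
Proof. by rewrite /sorted_flow; case: ifP. Qed.

Lemma sorted_flow_supp j k s : sorted_flow j k s != 0 -> - T < s < 0.
Proof.
rewrite /sorted_flow; case: ifPn; rewrite ?eqxx// => /and4P[ajs _ sa _] _.
rewrite -a0 -aJ (le_lt_trans _ ajs) ?(lt_le_trans sa)//; exact: a_homo.
Qed.

Lemma measurable_sorted_flow (S : set R) j k : measurable_fun S (sorted_flow j k).
Proof.
apply: (@measurable_funS _ _ _ _ setT) => //.
rewrite (_ : sorted_flow j k = fun s => mu * \1_(I j k) s); last first.
  by apply/funext => s; exact: sorted_flowE.
by apply: measurable_funM => //; apply: measurable_indic; exact: measurable_itv.
Qed.

Let integral_sorted_flow_indic (D : set R) j k : measurable D ->
  (\int[leb]_(s in D) (sorted_flow j k s)%:E)%E = (mu%:E * leb (I j k `&` D))%E.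
Proof.
move=> mD; under eq_integral do rewrite sorted_flowE EFinM.
rewrite ge0_integralZl_EFin// ?integral_indic//.
  exact: measurable_itv.
by apply: measurableT_comp => //; apply: measurable_indic; exact: measurable_itv.
Qed.

(** Since [a] and [b] both start at [- T], the times up to [s] given to the first [j] locations and
    the first [k] jobs fill an interval from [- T] to this point, up to null sets. Its length times
    [mu] is the cumulative flow. *)
Definition sorted_volume (s : R) (j k : nat) : R := Num.min s (Num.min (a j) (b k)).

Lemma integral_sorted_flow j k s : - T <= s <= 0 ->
  (\int[leb]_(t in `[(- T)%R, s]) (sorted_flow j k t)%:E)%E =
  (mu * mixed_diff (sorted_volume s) j k)%:E.
Proof.
move=> /andP[Ts s0]; rewrite integral_sorted_flow_indic//.
rewrite /mixed_diff /sorted_volume -overlap_mixed_diff ?a_homo ?b_homo//.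
rewrite EFinM; congr (_ * _)%E; rewrite /I.
set m := Num.max _ _; set M := Num.min _ _.
have Tm : - T <= m by rewrite -a0 le_max a_homo.
have [sM|Ms] := ltP s M.
- rewrite (_ : _ `&` _ = `]m, s]%classic); last first.
    apply/seteqP; split=> t /=; rewrite !in_itv/=.
      by move=> [/andP[-> _] /andP[_ ->]].
    move=> /andP[mt ts]; rewrite mt ts (le_lt_trans ts sM)/=; split => //.
    by rewrite andbT (le_trans Tm)// ltW.
  rewrite lebesgue_measure_itv/= lte_fin; case: ifPn; last rewrite -leNgt => ms.
    by move=> ms; rewrite EFinN -EFinD max_r// subr_ge0 ltW.
  by rewrite max_l// subr_le0.
- rewrite (_ : _ `&` _ = `]m, M[%classic); last first.
    apply/seteqP; split=> t /=; rewrite !in_itv/=; first by case.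
    move=> /andP[mt tM]; rewrite mt tM; split => //.
    by rewrite (le_trans Tm)/= ?(le_trans _ Ms)// ltW.
  rewrite lebesgue_measure_itv/= lte_fin; case: ifPn; last rewrite -leNgt => ms.
    by move=> ms; rewrite EFinN -EFinD max_r// subr_ge0 ltW.
  by rewrite max_l// subr_le0.
Qed.

Lemma integral_sorted_flow_support (S : set R) j k : measurable S -> 0 <= T ->
  `[- T, 0] `<=` S ->
  (\int[leb]_(s in S) (sorted_flow j k s)%:E)%E =
  (mu * mixed_diff (sorted_volume 0) j k)%:E.
Proof.
move=> mS T0 TS; rewrite -integral_sorted_flow ?lexx ?oppr_le0 ?T0//.
rewrite !integral_sorted_flow_indic//; congr (_ * leb _)%E.
have IT : I j k `<=` `[- T, 0].
  move=> s; rewrite /I /= !in_itv/= gt_max lt_min => /andP[/andP[/ltW ajs _] /andP[/ltW sa _]].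
  by rewrite -a0 -aJ (le_trans _ ajs) ?(le_trans sa)//; exact: a_homo.
by rewrite !setIidl//; exact: subset_trans TS.
Qed.

Let a_ge n : - T <= a n. Proof. by rewrite -a0; exact: a_homo. Qed.
Let b_ge n : - T <= b n. Proof. by rewrite -b0; exact: b_homo. Qed.

Lemma sorted_volume0l s m : - T <= s -> sorted_volume s 0 m = - T.
Proof. by move=> Ts; rewrite /sorted_volume a0 (min_l (b_ge _)) min_r. Qed.

Lemma sorted_volume0r s n : - T <= s -> sorted_volume s n 0 = - T.
Proof. by move=> Ts; rewrite /sorted_volume b0 (min_r (a_ge _)) min_r. Qed.

Lemma sorted_flow_location (S : set R) (j : 'I_J.+1) : measurable S -> 0 <= T ->
  `[- T, 0] `<=` S ->
  (\sum_(k < K.+1) \int[leb]_(s in S) (sorted_flow j k s)%:E)%E =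
  (mu * (a j.+1 - a j))%:E.
Proof.
move=> mS T0 TS; under eq_bigr do rewrite integral_sorted_flow_support//.
rewrite sumEFin -mulr_sumr; congr (_ * _)%:E.
rewrite (eq_bigl (fun k : 'I_K.+1 => (k < K.+1)%N)); last by move=> k; rewrite ltn_ord.
rewrite sum_mixed_diff// !sorted_volume0r ?oppr_le0// subrr subr0.
have v n : (n <= J.+1)%N -> sorted_volume 0 n K.+1 = a n.
  move=> nJ; have an0 : a n <= 0 by rewrite -aJ; exact: a_homo.
  by rewrite /sorted_volume bK (min_l an0) min_r.
by rewrite !v// ltnW.
Qed.

Lemma sorted_flow_job (S : set R) (k : 'I_K.+1) : measurable S -> 0 <= T ->
  `[- T, 0] `<=` S ->
  (\sum_(j < J.+1) \int[leb]_(s in S) (sorted_flow j k s)%:E)%E =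
  (mu * (b k.+1 - b k))%:E.
Proof.
move=> mS T0 TS; under eq_bigr do rewrite integral_sorted_flow_support//.
rewrite sumEFin -mulr_sumr; congr (_ * _)%:E.
rewrite (eq_bigl (fun j : 'I_J.+1 => (j < J.+1)%N)); last by move=> j; rewrite ltn_ord.
have -> : \sum_(j < J.+1 | (j < J.+1)%N) mixed_diff (sorted_volume 0) j k =
    \sum_(j < J.+1 | (j < J.+1)%N) mixed_diff (fun m n => sorted_volume 0 n m) k j.
  apply: eq_bigr => j _; rewrite /mixed_diff; ring.
rewrite sum_mixed_diff// !sorted_volume0l ?oppr_le0// subrr subr0.
have v n : (n <= K.+1)%N -> sorted_volume 0 J.+1 n = b n.
  move=> nK; have bn0 : b n <= 0 by rewrite -bK; exact: b_homo.
  by rewrite /sorted_volume aJ (min_r bn0) min_r.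
by rewrite !v// ltnW.
Qed.

Lemma sorted_flow_cumulative (n m : nat) s : (n <= J.+1)%N -> (m <= K.+1)%N ->
  - T <= s <= 0 ->
  (\sum_(j < J.+1 | (j < n)%N) \sum_(k < K.+1 | (k < m)%N)
     \int[leb]_(t in `[(- T)%R, s]) (sorted_flow j k t)%:E)%E =
  (mu * (sorted_volume s n m + T))%:E.
Proof.
move=> nJ mK Ts0; have /andP[Ts _] := Ts0.
under eq_bigr => j _.
  under eq_bigr do rewrite integral_sorted_flow//.
  rewrite sumEFin -mulr_sumr; over.
rewrite sumEFin -mulr_sumr sum_sum_mixed_diff//.
by rewrite !sorted_volume0l// sorted_volume0r// subrr subr0 opprK.
Qed.

End sorted_flow.

(** The number of interior thresholds below [s] is the slot containing [s]; since [s] meets none of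
    them, all comparisons are strict. *)
Lemma active_index (R : realDomainType) (c : nat -> R) (N : nat) (s : R) :
  {homo c : i i' / (i <= i')%N >-> i <= i'} ->
  c 0%N < s -> s < c N.+1 -> (forall i, (i < N)%N -> c i.+1 != s) ->
  exists2 j, (j <= N)%N & [/\ c j < s, s < c j.+1 &
    forall i, (i < N)%N -> if (i < j)%N then c i.+1 < s else s < c i.+1].
Proof.
move=> c_homo c0 cN cs.
have [|j jN jP] := @initial_segment_bound (fun i => c i.+1 < s) N.
  by move=> i i' /andP[ii' _]; apply: le_lt_trans; exact: c_homo.
have sc i : (i < N)%N -> (j <= i)%N -> s < c i.+1.
  by move=> iN ji; rewrite lt_neqAle eq_sym cs//= leNgt -jP// -leqNgt.
exists j => //; split.
- by case: j jN jP {sc} => // j jN jP; rewrite -jP// ltnS.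
- have [jN'|Nj] := ltnP j N; first exact: sc.
  by rewrite (_ : j = N)//; apply/eqP; rewrite eqn_leq jN.
- by move=> i iN; case: ltnP => [ij|ji]; [rewrite -jP|exact: sc].
Qed.

(** * Monotone increments of the commuting cost *)

Section commuting_cost.
Context (R : realType) (J K : nat) (l alpha beta gamma : nat -> R) (f g : R -> R).
Hypotheses (l_decr : forall i j, (i < j <= J)%N -> l j < l i)
  (alpha_incr : forall i k, (i < k <= K)%N -> alpha i < alpha k)
  (beta_gt0 : 0 < beta 0%N)
  (beta_incr : forall i k, (i < k <= K)%N -> beta i < beta k)
  (gamma_gt0 : 0 < gamma 0%N)
  (gamma_incr : forall i k, (i < k <= K)%N -> gamma i < gamma k)
  (f_decr : forall s s', s < s' -> s' <= 0 -> f s' < f s)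
  (g_decr : forall t t', t < t' -> t' <= - l J -> g t' < g t)
  (g_incr_decr : forall c d, c < d -> - c <= - l J -> forall s s', s < s' -> s' <= 0 ->
     g (s' - c) - g (s' - d) < g (s - c) - g (s - d)).

Definition commuting_cost (j k : nat) (s : R) : R :=
  alpha k * l j + beta k * f s + gamma k * g (s - l j).
Local Notation c := commuting_cost.

Let le_of_lt (h : nat -> R) (N : nat) :
  (forall i k, (i < k <= N)%N -> h i < h k) -> forall i k, (i <= k <= N)%N -> h i <= h k.
Proof.
move=> hlt i k /andP[]; rewrite leq_eqVlt => /orP[/eqP->//|ik kN].
by apply/ltW/hlt; rewrite ik.
Qed.

Let l_ge j : (j <= J)%N -> - l j <= - l J.
Proof.
rewrite lerN2 leq_eqVlt => /orP[/eqP->//|jJ].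
by apply/ltW/l_decr; rewrite jJ /=.
Qed.

Let gamma_pos k : (k <= K)%N -> 0 < gamma k.
Proof. by move=> kK; apply: lt_le_trans gamma_gt0 (le_of_lt gamma_incr _); rewrite kK. Qed.

Let beta_pos k : (k <= K)%N -> 0 < beta k.
Proof. by move=> kK; apply: lt_le_trans beta_gt0 (le_of_lt beta_incr _); rewrite kK. Qed.

Let arg_le j s : (j <= J)%N -> s <= 0 -> s - l j <= - l J.
Proof. by move=> jJ s0; apply: le_trans (l_ge jJ); rewrite gerDr. Qed.

(** The [beta] term cancels in the mixed difference. The other two are products of a factor
    increasing in [k] ([alpha] or [gamma]) and one decreasing in [j] ([l j] or [g (s - l j)]). *)
Lemma commuting_cost_submodular j j' k k' s : (j <= j' <= J)%N -> (k <= k' <= K)%N ->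
  s <= 0 -> c j' k' s + c j k s <= c j' k s + c j k' s.
Proof.
move=> /andP[]; rewrite leq_eqVlt => /orP[/eqP-> _ _ _|jj' j'J kk' s0].
  by rewrite addrC.
have dl : l j' < l j by apply: l_decr; rewrite jj'.
have dg : g (s - l j') < g (s - l j).
  by apply: g_decr; rewrite ?arg_le// ltrD2l ltrN2.
have da := le_of_lt alpha_incr kk'; have dc := le_of_lt gamma_incr kk'.
rewrite -subr_le0.
have -> : c j' k' s + c j k s - (c j' k s + c j k' s) =
  - ((alpha k' - alpha k) * (l j - l j')
     + (gamma k' - gamma k) * (g (s - l j) - g (s - l j'))).
  by rewrite /c; ring.
by rewrite oppr_le0 addr_ge0// mulr_ge0// subr_ge0// ltW.
Qed.

Lemma commuting_cost_decr j k s s' : (j <= J)%N -> (k <= K)%N -> s < s' -> s' <= 0 ->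
  c j k s' < c j k s.
Proof.
move=> jJ kK ss' s'0; rewrite /c; apply: ltrD.
  by rewrite ltrD2l ltr_pM2l ?beta_pos// f_decr.
by rewrite ltr_pM2l ?gamma_pos// g_decr ?arg_le// ltrD2r.
Qed.

(** In a location increment the [alpha] term is constant in time and the [beta] term cancels; the
    remaining increment of [g] decreases by concavity. *)
Lemma commuting_cost_diff1_decr i k s s' : (i < J)%N -> (k <= K)%N -> s < s' -> s' <= 0 ->
  diff1 c i k s' < diff1 c i k s.
Proof.
move=> iJ kK ss' s'0.
have dl : l i.+1 < l i by apply: l_decr; rewrite ltnSn.
have := g_incr_decr dl (l_ge iJ) ss' s'0.
rewrite -subr_gt0 -(pmulr_rgt0 _ (gamma_pos kK)) => H.
rewrite -subr_gt0; apply: lt_le_trans H _; rewrite le_eqVlt; apply/orP; left; apply/eqP.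
by rewrite /diff1 /c; ring.
Qed.

Lemma commuting_cost_diff2_decr j m s s' : (j <= J)%N -> (m < K)%N -> s < s' -> s' <= 0 ->
  diff2 c j m s' < diff2 c j m s.
Proof.
move=> jJ mK ss' s'0.
have db : beta m < beta m.+1 by apply: beta_incr; rewrite ltnSn.
have dc : gamma m < gamma m.+1 by apply: gamma_incr; rewrite ltnSn.
have df : f s' < f s by exact: f_decr.
have dg : g (s' - l j) < g (s - l j) by apply: g_decr; rewrite ?arg_le// ltrD2r.
rewrite -subr_gt0.
have -> : diff2 c j m s - diff2 c j m s' = (beta m.+1 - beta m) * (f s - f s')
    + (gamma m.+1 - gamma m) * (g (s - l j) - g (s' - l j)).
  by rewrite /diff2 /c; ring.
by rewrite addr_gt0// mulr_gt0// subr_gt0.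
Qed.

Lemma commuting_cost_potentials (a b : nat -> R) :
  {homo a : i i' / (i <= i')%N >-> i <= i'} ->
  {homo b : i i' / (i <= i')%N >-> i <= i'} ->
  a J.+1 = 0 -> b K.+1 = 0 ->
  exists phi psi : nat -> R,
    [/\ phi 0%N = 0, psi 0%N = 0 &
    forall s j' k', s <= 0 -> (j' <= J)%N -> (k' <= K)%N ->
      (forall i, (i < J)%N -> if (i < j')%N then a i.+1 < s else s < a i.+1) ->
      (forall m, (m < K)%N -> if (m < k')%N then b m.+1 < s else s < b m.+1) ->
      forall j k, (j <= J)%N -> (k <= K)%N -> (j, k) != (j', k') ->
      c j' k' s - phi j' - psi k' < c j k s - phi j - psi k].
Proof.
move=> a_homo b_homo aJ bK.
(* Increment [i] leads from location [i] to [i.+1], and this switch takes place at [a i.+1]; hence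
   the shift, for jobs as well. *)
apply: (@dual_potentials _ c J K (fun i => a i.+1) (fun m => b m.+1) 0).
- move=> i k k' s iJ kk' s0.
  have := @commuting_cost_submodular i i.+1 k k' s _ kk' s0; rewrite leqnSn iJ => /(_ isT).
  by rewrite /diff1; lra.
- move=> j j' m s mK jj' s0.
  have := @commuting_cost_submodular j j' m m.+1 s jj' _ s0; rewrite leqnSn mK => /(_ isT).
  by rewrite /diff2; lra.
- exact: commuting_cost_diff1_decr.
- exact: commuting_cost_diff2_decr.
- by move=> i i' _ _ ii'; exact: a_homo.
- by move=> m m' _ _ mm'; exact: b_homo.
- by move=> i iJ; rewrite -aJ; apply: a_homo; exact: leqW.
- by move=> m mK; rewrite -bK; apply: b_homo; exact: leqW.
Qed.

End commuting_cost.

(** * Partial sums and almost-everywhere statements *)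

(** Defined at every natural number and constant from [N] on, so that switching times are monotone
    sequences without side conditions. *)
Definition partial_sum (R : nmodType) (N : nat) (F : 'I_N -> R) (n : nat) : R :=
  \sum_(i < N | (i < n)%N) F i.

Lemma partial_sum0 (R : nmodType) (N : nat) (F : 'I_N -> R) : partial_sum F 0 = 0.
Proof. by rewrite /partial_sum big_pred0. Qed.

Lemma partial_sum_full (R : nmodType) (N : nat) (F : 'I_N -> R) :
  partial_sum F N = \sum_i F i.
Proof. by apply: eq_bigl => i; rewrite ltn_ord. Qed.

Lemma partial_sumS (R : nmodType) (N : nat) (F : 'I_N -> R) (i : 'I_N) :
  partial_sum F i.+1 = partial_sum F i + F i.
Proof.
rewrite /partial_sum (bigD1 i)//= addrC; congr (_ + _); apply: eq_bigl => j.
by rewrite ltnS ltn_neqAle andbC.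
Qed.

Lemma partial_sum_homo (R : numDomainType) (N : nat) (F : 'I_N -> R) :
  (forall i, 0 <= F i) -> {homo partial_sum F : n m / (n <= m)%N >-> n <= m}.
Proof.
move=> F0 n m nm; rewrite /partial_sum [leLHS]big_mkcond [leRHS]big_mkcond/=.
apply: ler_sum => i _; case: ifPn => [i_n|_]; last by case: ifP.
by rewrite (leq_trans i_n nm).
Qed.

Lemma ae_neq_seq (R : realType) (S : set R) (a : nat -> R) :
  ae_on S (fun s => forall n, a n != s).
Proof.
have F := ae_filter_ringOfSetsType (@lebesgue_measure R).
suff : {ae @lebesgue_measure R, forall s, forall n, a n != s}.
  by apply: filterS => s ? _.
apply: ae_foralln => n; exists [set a n]; split => //; first exact: lebesgue_measure_set1.
by move=> s /= /negP; rewrite negbK => /eqP ->.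
Qed.

Lemma ae_on_forall (R : realType) (S : set R) (I : finType) (P : I -> R -> Prop) :
  (forall i, ae_on S (P i)) -> ae_on S (fun s => forall i, P i s).
Proof.
move=> HP; have F := ae_filter_ringOfSetsType (@lebesgue_measure R).
rewrite /ae_on; apply: filterS (filter_forall F HP) => s H Ss i; exact: H.
Qed.

Lemma ae_on_and (R : realType) (S : set R) (P Q : R -> Prop) :
  ae_on S P -> ae_on S Q -> ae_on S (fun s => P s /\ Q s).
Proof. by apply: ae_onS2. Qed.

(** * Pointwise behaviour and feasibility of the sorted flow *)

Section sorted_flow_pointwise.
Context (R : realType) (J K : nat) (a b : nat -> R) (mu : R).
Hypotheses (a_homo : {homo a : i j / (i <= j)%N >-> i <= j}).
Hypotheses (b_homo : {homo b : i j / (i <= j)%N >-> i <= j}).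
Hypothesis mu_ge0 : 0 <= mu.
Notation x := (@sorted_flow R J K a b mu).

Lemma sorted_flow_active (j' : 'I_J.+1) (k' : 'I_K.+1) s :
  a j' < s < a j'.+1 -> b k' < s < b k'.+1 ->
  forall p : 'I_J.+1 * 'I_K.+1, x p.1 p.2 s = if p == (j', k') then mu else 0.
Proof.
move=> /andP[aj ja] /andP[bk kb] [j k]; rewrite /sorted_flow /= xpair_eqE.
have uniq (h : nat -> R) i i' : {homo h : i j / (i <= j)%N >-> i <= j} ->
    h i < s -> s < h i.+1 -> h i' < s -> s < h i'.+1 -> (i <= i')%N.
  move=> h_homo hi _ _ hi'; rewrite leqNgt; apply/negP => ii'.
  by have := lt_trans (le_lt_trans (h_homo _ _ ii') hi) hi'; rewrite ltxx.
case: ifPn => [/and4P[ajs bks sa sb]|].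
  have -> : j = j'.
    by apply/val_inj/anti_leq; rewrite (uniq a j j')// (uniq a j' j).
  have -> : k = k'.
    by apply/val_inj/anti_leq; rewrite (uniq b k k')// (uniq b k' k).
  by rewrite !eqxx.
by case: ifPn => // /andP[/eqP-> /eqP->]; rewrite aj ja bk kb.
Qed.

Variable T : R.
Hypotheses (a0 : a 0%N = - T) (b0 : b 0%N = - T) (aJ : a J.+1 = 0) (bK : b K.+1 = 0).

Lemma exists_active s : - T < s < 0 -> (forall n, a n != s) -> (forall n, b n != s) ->
  exists (j' : 'I_J.+1) (k' : 'I_K.+1),
    [/\ a j' < s < a j'.+1, b k' < s < b k'.+1,
        forall i, (i < J)%N -> if (i < j')%N then a i.+1 < s else s < a i.+1 &
        forall m, (m < K)%N -> if (m < k')%N then b m.+1 < s else s < b m.+1].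
Proof.
move=> /andP[Ts s0] as_ bs_.
have [||j jJ [aj ja aP]] := active_index a_homo _ _ (fun i (_ : (i < J)%N) => as_ i.+1).
- by rewrite a0.
- by rewrite aJ.
have [||k kK [bk kb bP]] := active_index b_homo _ _ (fun i (_ : (i < K)%N) => bs_ i.+1).
- by rewrite b0.
- by rewrite bK.
have jJ' : (j < J.+1)%N by []; have kK' : (k < K.+1)%N by [].
by exists (Ordinal jJ'), (Ordinal kK'); rewrite /= aj ja bk kb.
Qed.

Lemma sorted_flow_capacity s : (forall n, a n != s) -> (forall n, b n != s) ->
  \sum_(j < J.+1) \sum_(k < K.+1) x j k s <= mu.
Proof.
move=> as_ bs_; rewrite pair_bigA/=.
have [Ts0|Ts0] := boolP (- T < s < 0).
  have [j' [k' [aj bk _ _]]] := exists_active Ts0 as_ bs_.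
  under eq_bigr do rewrite (sorted_flow_active aj bk).
  by rewrite -big_mkcond big_pred1_eq.
rewrite big1// => p _; apply/eqP; apply: contraNT Ts0.
exact: (@sorted_flow_supp _ _ _ _ _ _ _ a_homo a0 aJ).
Qed.

End sorted_flow_pointwise.

Lemma sorted_flow_feasible (R : realType) (J K : nat) (a b : nat -> R) (T mu : R)
    (Rj : 'I_J.+1 -> R) (Qk : 'I_K.+1 -> R) (S : set R) :
  {homo a : i j / (i <= j)%N >-> i <= j} -> {homo b : i j / (i <= j)%N >-> i <= j} ->
  a 0%N = - T -> b 0%N = - T -> a J.+1 = 0 -> b K.+1 = 0 -> 0 <= mu -> 0 <= T ->
  (forall j : 'I_J.+1, mu * (a j.+1 - a j) = Rj j) ->
  (forall k : 'I_K.+1, mu * (b k.+1 - b k) = Qk k) ->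
  measurable S -> `[- T, 0] `<=` S ->
  feasible S mu Rj Qk (@sorted_flow R J K a b mu).
Proof.
move=> a_homo b_homo a0 b0 aJ bK mu0 T0 aR bQ mS TS; split.
- by move=> j k; exact: measurable_sorted_flow.
- move=> j k; rewrite /ae_on; apply: aeW => s _; exact: sorted_flow_ge0.
- apply: ae_onS2 (ae_neq_seq S a) (ae_neq_seq S b) => s _.
  exact: (@sorted_flow_capacity _ _ _ _ _ _ a_homo b_homo mu0 T).
- by move=> j; rewrite (@sorted_flow_location _ _ _ _ _ T) ?aR.
- by move=> k; rewrite (@sorted_flow_job _ _ _ _ _ T) ?bQ.
Qed.

Theorem proposition7p2 (R : realType) (J K : nat)
  (l : 'I_J.+1 -> R) (alpha beta gamma : 'I_K.+1 -> R)
  (f f' g g' g'' : R -> R) (mu : R) (Rj : 'I_J.+1 -> R) (Qk : 'I_K.+1 -> R)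
  (Q T : R) (S : set R)
  (l_decr : forall i j : 'I_J.+1, (i < j)%N -> l j < l i)
  (alpha_gt0 : 0 < alpha ord0)
  (alpha_incr : forall i k : 'I_K.+1, (i < k)%N -> alpha i < alpha k)
  (beta_gt0 : 0 < beta ord0)
  (beta_incr : forall i k : 'I_K.+1, (i < k)%N -> beta i < beta k)
  (gamma_gt0 : 0 < gamma ord0)
  (gamma_incr : forall i k : 'I_K.+1, (i < k)%N -> gamma i < gamma k)
  (f_cont : {within `]-oo, 0], continuous f})
  (f_ge0 : forall s : R, s <= 0 -> 0 <= f s)
  (f_derive : forall s : R, s <= 0 -> is_derive_within `]-oo, 0] f s (f' s))
  (f'_lt0 : forall s : R, s <= 0 -> f' s < 0)
  (g_cont : {within `]-oo, - l ord_max], continuous g})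
  (g_gt0 : forall t : R, t <= - l ord_max -> 0 < g t)
  (g_derive : forall t : R, t <= - l ord_max ->
    is_derive_within `]-oo, - l ord_max] g t (g' t))
  (g'_lt0 : forall t : R, t <= - l ord_max -> g' t < 0)
  (g'_derive : forall t : R, t <= - l ord_max ->
    is_derive_within `]-oo, - l ord_max] g' t (g'' t))
  (g''_lt0 : forall t : R, t <= - l ord_max -> g'' t < 0)
  (mu_gt0 : 0 < mu)
  (Rj_gt0 : forall j, 0 < Rj j)
  (Qk_gt0 : forall k, 0 < Qk k)
  (sum_Rj : \sum_(j < J.+1) Rj j = Q)
  (sum_Qk : \sum_(k < K.+1) Qk k = Q)
  (T_def : T = Q / mu)
  (S_interval : is_interval S)
  (S_long : `[- T, 0] `<=` S) :
  exists x : flow R J K,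
    [/\ is_solution S mu Rj Qk (cost l alpha beta gamma f g) x,
        forall y : flow R J K,
          is_solution S mu Rj Qk (cost l alpha beta gamma f g) y ->
          forall j k, ae_on S (fun s => y j k s = x j k s)
      & forall zeta kappa s : R,
          1 <= zeta <= J.+1%:R -> 1 <= kappa <= K.+1%:R -> - T <= s <= 0 ->
          cumulative_flow T x zeta kappa s =
          (Num.min (Num.min (\sum_(j < J.+1 | j.+1%:R <= zeta) Rj j)
                            (\sum_(k < K.+1 | k.+1%:R <= kappa) Qk k))
                   (mu * (T + s)))%:E].
Proof.
(* Extension to natural indices. Out of range [inord] returns index 0, so monotonicity holds only up
   to [J] and [K]. *)
pose lN i := l (inord i); pose aN k := alpha (inord k).
pose bN k := beta (inord k); pose cN k := gamma (inord k).
pose c := commuting_cost lN aN bN cN f g.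
have lN_decr i j : (i < j <= J)%N -> lN j < lN i.
  move=> /andP[ij jJ]; apply: l_decr.
  by rewrite !inordK// ltnS// (leq_trans (ltnW ij)).
have incrN (h : 'I_K.+1 -> R) : (forall i k : 'I_K.+1, (i < k)%N -> h i < h k) ->
    forall i k, (i < k <= K)%N -> h (inord i) < h (inord k).
  move=> hi i k /andP[ik kK]; apply: hi.
  by rewrite !inordK// ltnS// (leq_trans (ltnW ik)).
have aN_incr := incrN _ alpha_incr; have bN_incr := incrN _ beta_incr.
have cN_incr := incrN _ gamma_incr.
have inord0 : inord 0 = ord0 :> 'I_K.+1 by apply/val_inj; rewrite /= inordK.
have bN0 : 0 < bN 0%N by rewrite /bN inord0.
have cN0 : 0 < cN 0%N by rewrite /cN inord0.
have lJ : lN J = l ord_max by congr l; apply/val_inj; rewrite /= inordK.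
have f_decr := decreasing_of_derive_within f_cont f_derive f'_lt0.
have g_decr : forall t t', t < t' -> t' <= - lN J -> g t' < g t.
  by rewrite lJ; exact: (decreasing_of_derive_within g_cont g_derive g'_lt0).
have g_incr_decr : forall d e, d < e -> - d <= - lN J -> forall s s', s < s' -> s' <= 0 ->
    g (s' - d) - g (s' - e) < g (s - d) - g (s - e).
  by rewrite lJ => d e; exact: (decreasing_increment g_cont g_derive g'_derive g''_lt0).
have c_decr := @commuting_cost_decr R J K lN aN bN cN f g lN_decr bN0 bN_incr cN0 cN_incr
  f_decr g_decr.
have Q_gt0 : 0 < Q.
  by rewrite -sum_Rj big_ord_recl ltr_pwDl// sumr_ge0// => j _; exact: ltW.
have T_gt0 : 0 < T by rewrite T_def divr_gt0.
(* The moments at which a bottleneck running at full capacity from [- T] has served the first [n]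
   locations, respectively jobs; by [T = Q / mu] both sequences end at 0. *)
pose a n := - T + partial_sum Rj n / mu; pose b n := - T + partial_sum Qk n / mu.
have time_homo (N : nat) (F : 'I_N -> R) : (forall i, 0 < F i) ->
    {homo (fun n => - T + partial_sum F n / mu) : i j / (i <= j)%N >-> i <= j}.
  move=> F0 i j ij; rewrite lerD2l ler_pM2r ?invr_gt0//.
  by apply: partial_sum_homo => // k; exact: ltW.
have a_homo : {homo a : i j / (i <= j)%N >-> i <= j} by exact: time_homo.
have b_homo : {homo b : i j / (i <= j)%N >-> i <= j} by exact: time_homo.
have a0 : a 0%N = - T by rewrite /a partial_sum0 mul0r addr0.
have b0 : b 0%N = - T by rewrite /b partial_sum0 mul0r addr0.
have aJ : a J.+1 = 0 by rewrite /a partial_sum_full sum_Rj T_def addNr.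
have bK : b K.+1 = 0 by rewrite /b partial_sum_full sum_Qk T_def addNr.
have mu_neq0 : mu != 0 by rewrite gt_eqF.
have mu_time x : mu * (- T + x / mu + T) = x.
  by rewrite addrAC addNr add0r mulrC divfK.
have aR (j : 'I_J.+1) : mu * (a j.+1 - a j) = Rj j.
  by rewrite /a partial_sumS; field.
have bQ (k : 'I_K.+1) : mu * (b k.+1 - b k) = Qk k.
  by rewrite /b partial_sumS; field.
have [phi [psi [phi0 psi0 c_min]]] := @commuting_cost_potentials R J K lN aN bN cN f g
  lN_decr aN_incr bN_incr cN0 cN_incr f_decr g_decr g_incr_decr
  a b a_homo b_homo aJ bK.
have mS : measurable S by exact: is_interval_measurable.
have mu_ge0 := ltW mu_gt0; have T_ge0 := ltW T_gt0.
pose x := @sorted_flow R J K a b mu.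
have fx : feasible S mu Rj Qk x by exact: (@sorted_flow_feasible _ _ _ a b T).
(* [f] and [g] are controlled only up to the deadline. The value 0 after it keeps the cost
   measurable and bounded below on all of [S]; the infinite penalty is carried by the extended
   cost. *)
pose cR (j : 'I_J.+1) (k : 'I_K.+1) s : R := if s <= 0 then c j k s else 0.
have costE : cost l alpha beta gamma f g =
    fun j k s => if s <= 0 then (cR j k s)%:E else +oo%E.
  apply/funext => j; apply/funext => k; apply/funext => s.
  rewrite /cost /cR; case: (s <= 0) => //.
  by rewrite /c /commuting_cost /lN /aN /bN /cN !inord_val.
have lN_ge (j : 'I_J.+1) : - lN j <= - l ord_max.
  rewrite -lJ lerN2; have := ltn_ord j; rewrite ltnS leq_eqVlt => /orP[/eqP->//|jJ].
  by apply/ltW/lN_decr; rewrite jJ /=.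
have mcR j k : measurable_fun S (cR j k).
  pose neg : set R := `]-oo, 0]%classic; have m0 : measurable neg by exact: measurable_itv.
  apply: measurable_fun_if => //.
  - by apply: (@measurable_funS _ _ _ _ setT) => //; apply: measurable_fun_ler.
  - apply: (measurable_funS m0).
      by move=> s [_ /= s0]; rewrite /neg /= in_itv.
    have mf : measurable_fun neg f by exact: subspace_continuous_measurable_fun.
    have mg : measurable_fun neg (fun s => g (s - lN j)).
      apply: subspace_continuous_measurable_fun => //.
      by apply: continuous_within_shift g_cont _; rewrite sub0r lN_ge.
    apply: measurable_funD; first apply: measurable_funD => //.
      by apply: measurable_funM.
    by apply: measurable_funM.
have beta_ge0 (k : 'I_K.+1) : 0 <= beta k.
  have [->|k0] := eqVneq k ord0; first exact: ltW.
  by apply/ltW/(lt_trans beta_gt0)/beta_incr; rewrite lt0n.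
have gamma_ge0 (k : 'I_K.+1) : 0 <= gamma k.
  have [->|k0] := eqVneq k ord0; first exact: ltW.
  by apply/ltW/(lt_trans gamma_gt0)/gamma_incr; rewrite lt0n.
(* Before the deadline only the [alpha] term can be negative, and it does not depend on time. *)
pose B (j : 'I_J.+1) (k : 'I_K.+1) := `|aN k * lN j|.
have cR_ge j k s : - B j k <= cR j k s.
  rewrite /cR; case: ifPn => s0; last by rewrite oppr_le0 normr_ge0.
  rewrite /c /commuting_cost -addrA.
  have : - B j k <= aN k * lN j by rewrite /B lerNl -normrN ler_norm.
  move=> /le_trans; apply; rewrite lerDl addr_ge0// mulr_ge0 ?f_ge0//.
  - by rewrite /bN inord_val.
  - by rewrite /cN inord_val.
  - by apply/ltW/g_gt0/(le_trans _ (lN_ge j)); rewrite gerDr.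
have x0 j k s : ~~ (- T < s < 0) -> x j k s = 0.
  move=> Ts; apply/eqP; apply: contraNT Ts; exact: sorted_flow_supp.
have x_ge0 j k s : 0 <= x j k s by exact: sorted_flow_ge0.
have cx j k s : ((if (s <= 0)%R then (cR j k s)%:E else +oo) * (x j k s)%:E)%E =
    (cR j k s * x j k s)%:E.
  case: (leP s 0) => s0; first by rewrite EFinM.
  by rewrite x0 ?mule0 ?mulr0// negb_and -!leNgt (ltW s0) orbT.
have x_foo : (objective S (fun j k s => if (s <= 0)%R then (cR j k s)%:E else +oo%E) x < +oo)%E.
  rewrite /objective; apply: lte_sum_pinfty => j _; apply: lte_sum_pinfty => k _.
  under eq_integral do rewrite cx.
  apply: (@integrable_lty _ _ _ (@lebesgue_measure R) S mS).
  (* On the support of [x] the cost lies between [- B j k] and its value at [- T], so [M] bounds its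
     absolute value. *)
  pose M := `|c j k (- T)| + B j k.
  have iM := integrableZl (mu := @lebesgue_measure R) mS M (flow_integrable mS fx j k).
  apply: (le_integrable (mu := @lebesgue_measure R) mS _ _ iM).
    by apply/measurable_EFinP; apply: measurable_funM; [exact: mcR|exact: measurable_sorted_flow].
  move=> s _; rewrite /= lee_fin normrM [leRHS]normrM.
  have [/andP[Ts s0]|/x0->] := boolP (- T < s < 0); last by rewrite normr0 !mulr0.
  have M_ge0 : 0 <= M by rewrite addr_ge0// /B normr_ge0.
  rewrite ler_wpM2r// [leRHS]ger0_norm//.
  rewrite ler_norml; apply/andP; split.
    by apply: le_trans (cR_ge j k s); rewrite lerN2 lerDr.
  have cT : c j k s <= c j k (- T) by apply/ltW/c_decr; rewrite ?leq_ord// ltW.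
  rewrite /cR (ltW s0) (le_trans cT)//.
  by apply: le_trans (ler_norm _) _; rewrite /M lerDl /B normr_ge0.
have gap y : feasible S mu Rj Qk y ->
  (forall j k, ae_on S (fun s => 0 < s -> y j k s = 0)) ->
  ae_on S (fun s =>
    0 <= reduced_gap cR x (fun j => phi j) (fun k => psi k) (c 0%N 0%N (- T)) y s /\
    (reduced_gap cR x (fun j => phi j) (fun k => psi k) (c 0%N 0%N (- T)) y s = 0 ->
     forall j k, y j k s = x j k s)).
  move=> fy y_late; have [_ y_ge0 y_cap _ _] := fy.
  have ends := ae_on_and (ae_neq_seq S a) (ae_neq_seq S b).
  have y_pos := ae_on_forall (fun p : 'I_J.+1 * 'I_K.+1 => y_ge0 p.1 p.2).
  have {}y_late := ae_on_forall (fun p : 'I_J.+1 * 'I_K.+1 => y_late p.1 p.2).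
  apply: ae_onS2 (ae_on_and ends y_cap) (ae_on_and y_pos y_late).
  move=> s _ [[as_ bs_] cap_s] [pos_s late_s].
  pose r (p : 'I_J.+1 * 'I_K.+1) := cR p.1 p.2 s - phi p.1 - psi p.2.
  rewrite /reduced_gap pair_bigA/=.
  suff [w0 wy] : 0 <= \sum_p (r p - c 0%N 0%N (- T)) * (y p.1 p.2 s - x p.1 p.2 s) /\
      (\sum_p (r p - c 0%N 0%N (- T)) * (y p.1 p.2 s - x p.1 p.2 s) = 0 ->
       forall p, y p.1 p.2 s = x p.1 p.2 s).
    by split=> // /wy yx j k; exact: (yx (j, k)).
  rewrite pair_bigA/= in cap_s.
  have [s0|s0|s0] := ltgtP s 0; last first.
  - by have := as_ J.+1; rewrite aJ s0 eqxx.
  - have xs p : x p.1 p.2 s = 0 by rewrite x0// negb_and -!leNgt (ltW s0) orbT.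
    split=> [|_ p]; last by rewrite xs late_s.
    by rewrite big1// => p _; rewrite xs late_s// subrr mulr0.
  have rE p : r p = c p.1 p.2 s - phi p.1 - psi p.2 by rewrite /r /cR (ltW s0).
  have [sT|Ts|Ts] := ltgtP s (- T); last first.
  - by have := as_ 0%N; rewrite a0 -Ts eqxx.
  - have Ts0 : - T < s < 0 by rewrite Ts.
    have [j' [k' [aj bk aP bP]]] := exists_active a_homo b_homo a0 b0 aJ bK Ts0 as_ bs_.
    have r_min (j k : nat) : (j <= J)%N -> (k <= K)%N -> (j, k) != (j' : nat, k' : nat) ->
        r (j', k') < c j k s - phi j - psi k.
      by move=> jJ kK jk; rewrite rE; apply: c_min => //; rewrite ?(ltW s0) ?leq_ord.
    apply: (@gap_of_active _ _ r (fun p => x p.1 p.2 s) (fun p => y p.1 p.2 s) _ mu pos_s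
      (j', k')) => //.
    + move=> [j k] jk; rewrite [ltRHS]rE; apply: r_min; rewrite ?leq_ord//.
    (* The reduced cost of [(0,0)] is [c 0 0 s], because its potentials vanish. It bounds the
       minimum from above and is already below [C]. *)
    + have c00 : c 0%N 0%N s < c 0%N 0%N (- T) by apply: c_decr => //; exact: ltW.
      have [E|jk] := eqVneq (0%N, 0%N) (j' : nat, k' : nat).
        by case: E => j0 k0; rewrite rE/= -j0 -k0 phi0 psi0 !subr0.
      by have := r_min _ _ (leq0n J) (leq0n K) jk; rewrite phi0 psi0 !subr0 => /lt_trans; apply.
    + by move=> q; apply: sorted_flow_active.
  apply: (@gap_of_inactive _ _ r (fun p => x p.1 p.2 s) (fun p => y p.1 p.2 s) _ pos_s)
    => p; last first.
    by rewrite x0// negb_and -!leNgt (ltW sT).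
  have c00 : c 0%N 0%N (- T) < c 0%N 0%N s by apply: c_decr => //; rewrite oppr_le0.
  apply: lt_le_trans c00 _; rewrite rE.
  have [E|jk] := eqVneq (p.1 : nat, p.2 : nat) (0%N, 0%N).
    by case: E => -> ->; rewrite phi0 psi0 !subr0.
  (* Before [- T] no switch has occurred, so the minimality statement applies with [(0,0)] in the
     role of the served pair. *)
  have below (h : nat -> R) i : {homo h : i j / (i <= j)%N >-> i <= j} ->
      h 0%N = - T -> s < h i.
    by move=> h_homo h0; apply: lt_le_trans sT _; rewrite -h0 h_homo.
  have := c_min s 0%N 0%N (ltW s0) (leq0n J) (leq0n K) _ _ p.1 p.2 (leq_ord _) (leq_ord _) jk.
  rewrite phi0 psi0 !subr0 => H; apply/ltW/H => i _; exact: below.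
exists x; rewrite costE.
have [x_sol x_uniq] := solution_of_reduced_gap mS mcR cR_ge (etrans sum_Rj (esym sum_Qk))
  fx x_foo gap.
split => // zeta kappa s zeta1 kappa1 Ts0.
(* A real bound selects an initial segment of indices, so cumulating up to [zeta] and [kappa] means
   cumulating over the first [n] locations and [m] jobs. *)
have index_bound (N : nat) (z : R) : exists2 n, (n <= N)%N &
    forall i : 'I_N, (i.+1%:R <= z) = (i < n)%N.
  have [|n nN nP] := @initial_segment_bound (fun i => i.+1%:R <= z) N.
    by move=> i i' /andP[ii' _]; apply: le_trans; rewrite ler_nat.
  by exists n => // i; rewrite nP.
have [n nJ nP] := index_bound J.+1 zeta; have [m mK mP] := index_bound K.+1 kappa.
rewrite (eq_bigl _ _ nP) (eq_bigl _ _ mP) /cumulative_flow (eq_bigl _ _ nP).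
under eq_bigr do rewrite (eq_bigl _ _ mP).
rewrite (sorted_flow_cumulative a_homo b_homo a0 b0 mu_ge0 nJ mK Ts0); congr _%:E.
have mu_min u v : mu * (Num.min u v + T) = Num.min (mu * (u + T)) (mu * (v + T)).
  by rewrite addr_minl minr_pMr.
by rewrite /sorted_volume !mu_min !mu_time minC (addrC s).
Qed.
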